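(* Let $\mathcal T=(T(t))_{t\ge0}$ be a $C_0$-semigroup on a Hilbert space $H$, and let $\tau_1>0$ be such that $T(\tau_1)$ is similar to a contraction on $H$. Then for every $\tau_2\in(0,\tau_1]$ there exist a Hilbert space $K$, $A\in\mathcal L(K,H)$, $B\in\mathcal L(H,K)$ and a unitary $C_0$-group $\mathcal U=(U(t))_{t\in\mathbb R}$ on $K$ such that $$T(t)=AU(t)B,\qquad t\ge\tau_2,$$ and $$\|A\|\|B\|\le C(T(\tau_1))\,M^2\sqrt{\tau_1/\tau_2},$$ where $M=\sup_{t\in[0,\tau_1]}\|T(t)\|$.
   Context: For $T\in\mathcal L(H)$, its similarity constant is $C(T)=\inf\{\|R\|\|R^{-1}\|: R\in\mathcal L(H)\text{ invertible},\ \|RTR^{-1}\|\le1\}$, with $C(T)=\infty$ if $T$ is not similar to a contraction (i.e. if no such $R$ exists). *)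

(* Defs.v *)
From Stdlib Require Import Reals.
From Coquelicot Require Import Coquelicot.
Open Scope R_scope.

Record Hilbert := {
  hspace :> CompleteNormedModule C_AbsRing;
  inner : hspace -> hspace -> C;
  inner_plus_l : forall x y z : hspace,
      inner (plus x y) z = Cplus (inner x z) (inner y z);
  inner_scal_l : forall (a : C) (x y : hspace),
      inner (scal a x) y = Cmult a (inner x y);
  inner_conj : forall x y : hspace, inner y x = Cconj (inner x y);
  inner_pos : forall x : hspace, 0 <= Re (inner x x);
  inner_definite : forall x : hspace, inner x x = RtoC 0 -> x = zero;
  inner_norm : forall x : hspace, norm x = sqrt (Re (inner x x))
}.

Definition bounded_linear {U V : NormedModule C_AbsRing} (f : U -> V) : Prop :=
  (forall x y, f (plus x y) = plus (f x) (f y)) /\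
  (forall (a : C) x, f (scal a x) = scal a (f x)) /\
  (exists M : R, forall x, norm (f x) <= M * norm x).

Definition opnorm {U V : NormedModule C_AbsRing} (f : U -> V) : Rbar :=
  Lub_Rbar (fun r => exists x : U, norm x <= 1 /\ r = norm (f x)).

(* Similarity constant C(T) = inf { ||R|| ||R^-1|| : R invertible in L(H),
   ||R T R^-1|| <= 1 }, = +oo if the set is empty (Glb of empty set is p_infty). *)
Definition sim_const {H : NormedModule C_AbsRing} (T : H -> H) : Rbar :=
  Glb_Rbar (fun r => exists R Ri : H -> H,
     bounded_linear R /\ bounded_linear Ri /\
     (forall x, R (Ri x) = x) /\ (forall x, Ri (R x) = x) /\
     Rbar_le (opnorm (fun x => R (T (Ri x)))) (Finite 1) /\
     Rbar_mult (opnorm R) (opnorm Ri) = Finite r).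

Definition C0_semigroup {H : NormedModule C_AbsRing} (T : R -> H -> H) : Prop :=
  (forall t, 0 <= t -> bounded_linear (T t)) /\
  (forall x, T 0 x = x) /\
  (forall s t x, 0 <= s -> 0 <= t -> T (s + t) x = T s (T t x)) /\
  (forall x, filterlim (fun t => T t x) (at_right 0) (locally x)).

Definition unitary {K : Hilbert} (U : K -> K) : Prop :=
  bounded_linear U /\
  (forall x y : K, inner K (U x) (U y) = inner K x y) /\
  (forall y : K, exists x : K, U x = y).

Definition unitary_C0_group {K : Hilbert} (U : R -> K -> K) : Prop :=
  (forall t, unitary (U t)) /\
  (forall x, U 0 x = x) /\
  (forall s t x, U (s + t) x = U s (U t x)) /\
  (forall x, filterlim (fun t => U t x) (locally 0) (locally x)).

Definition sup_norm_on {H : NormedModule C_AbsRing} (T : R -> H -> H) (tau : R) : Rbar :=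
  Lub_Rbar (fun r => exists t, 0 <= t <= tau /\ opnorm (T t) = Finite r).

Definition similar_to_contraction {H : NormedModule C_AbsRing} (T : H -> H) : Prop :=
  exists R Ri : H -> H,
     bounded_linear R /\ bounded_linear Ri /\
     (forall x, R (Ri x) = x) /\ (forall x, Ri (R x) = x) /\
     Rbar_le (opnorm (fun x => R (T (Ri x)))) (Finite 1).

(* Main.v *)
(** Start from operators making [T(tau1)] a contraction for the form [p(x,y) = b^2 <Sx,Sy>], with
    [|x|^2 <= p(x,x) <= C'^2 |x|^2] and [C'] close to [C(T(tau1))].  Averaging [p(T(s)x, T(s)y)]
    over [s] in [[0,tau1]] gives a semidefinite form [b] for which every [T(t)] is a contraction,
    with [b(x,x) <= C'^2 M^2 |x|^2]; since [|T(tau2)x| <= M |T(s)x|] for [s <= tau2], also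
    [(tau2/tau1) |T(tau2)x|^2 <= M^2 b(x,x)].  Riemann sums replace the integral, and an
    ultrafilter limit makes them invariant and replaces [C'] by the infimum.
    The group is the minimal unitary dilation of the semigroup on the [b]-space: the completion
    of the formal sums [U(t_1)x_1 + ... + U(t_n)x_n] under the kernel [b(T(s-t)x, y)] for
    [s >= t].  [B] embeds [H] at time [0].  [A] maps a sum with all [t_i >= tau2] to
    [T(t_1)x_1 + ... + T(t_n)x_n = T(tau2)(T(t_1-tau2)x_1 + ...)], which is bounded by
    [M sqrt(tau1/tau2)], and is extended by orthogonal projection. *)

From mathcomp Require filter.
Require Import Defs.
From Stdlib Require Import Reals Lra Lia List Permutation ClassicalEpsilon.
From Stdlib Require Import FunctionalExtensionality PropExtensionality.
From Coquelicot Require Import Coquelicot.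
Open Scope R_scope.

(** The constant splits as [C M] for [B] times [M sqrt(tau1/tau2)] for [A], with [C] the similarity
    constant. The delay [tau2] comes from the averaging: [b(x,x)] need not dominate any multiple of
    [|x|^2], only of [|T(tau2)x|^2], as the part of the average over [[0,tau2]] sees
    [T(tau2)x = T(tau2-s)T(s)x]. Contractivity is a telescoping effect: replacing [x] by [T(h)x]
    drops the values of [p] on [[0,h]] and adds those on [[tau1,tau1+h]], which are no larger. The
    bound involves the infimum [C] itself, which no single similarity need attain; nearly optimal
    operators need not converge, but their forms are uniformly bounded and converge pointwise along
    an ultrafilter. Since [b] may degenerate and formal sums obey no vector space laws, estimates go
    through pairings, and quotient and completion are taken in one step. Finiteness of [M] rests on
    uniform boundedness. *)

Ltac Cpair_ring := apply injective_projections; unfold Re, Im; simpl; ring.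

(** * Limits of complex sequences along a filter *)

(** The filter is a parameter because two kinds of limit occur: along [eventually] in the
    completion, along an ultrafilter in the averaging. *)
Definition tends (F : (nat -> Prop) -> Prop) (u : nat -> C) (l : C) : Prop :=
  forall e, 0 < e -> F (fun n => Cmod (u n - l) < e).

Lemma Cmod_eq_of_small (a b : C) : (forall e, 0 < e -> Cmod (a - b) < e) -> a = b.
Proof.
  intros H.
  assert (E : Cmod (a - b) = 0).
  { destruct (Rle_lt_or_eq_dec _ _ (Cmod_ge_0 (a - b))) as [h|h]; [|easy].
    specialize (H _ h); lra. }
  apply Cmod_eq_0 in E. replace a with ((a - b) + b)%C by ring. rewrite E; ring.
Qed.

Section Tends.

Context {F : (nat -> Prop) -> Prop} {FF : ProperFilter F}.

Lemma tends_unique (u : nat -> C) (l l' : C) : tends F u l -> tends F u l' -> l = l'.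
Proof.
  intros H H'. apply Cmod_eq_of_small. intros e he.
  destruct (filter_ex (F := F) _
    (filter_and (F := F) _ _ (H (e / 2) ltac:(lra)) (H' (e / 2) ltac:(lra)))) as [n [h h']].
  replace (l - l')%C with (- (u n - l) + (u n - l'))%C by ring.
  apply Rle_lt_trans with (1 := Cmod_triangle _ _). rewrite Cmod_opp. lra.
Qed.

Lemma tends_close (u v : nat -> C) (l : C) :
  (forall e, 0 < e -> F (fun n => Cmod (u n - v n) < e)) -> tends F u l -> tends F v l.
Proof.
  intros H H' e he.
  apply filter_imp with (2 := filter_and (F := F) _ _ (H (e / 2) ltac:(lra)) (H' (e / 2) ltac:(lra))).
  intros n [h h'].
  replace (v n - l)%C with (- (u n - v n) + (u n - l))%C by ring.
  apply Rle_lt_trans with (1 := Cmod_triangle _ _). rewrite Cmod_opp. lra.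
Qed.

Lemma tends_ext (u v : nat -> C) (l : C) : (forall n, u n = v n) -> tends F u l -> tends F v l.
Proof.
  intros H. apply tends_close. intros e he. apply filter_forall. intros n.
  rewrite H. replace (v n - v n)%C with (RtoC 0) by ring. rewrite Cmod_0. easy.
Qed.

Lemma tends_const (l : C) : tends F (fun _ => l) l.
Proof.
  intros e he. apply filter_forall. intros _.
  replace (l - l)%C with (RtoC 0) by ring. rewrite Cmod_0. easy.
Qed.

Lemma tends_plus (u v : nat -> C) (l m : C) :
  tends F u l -> tends F v m -> tends F (fun n => (u n + v n)%C) (l + m)%C.
Proof.
  intros H H' e he.
  apply filter_imp with (2 := filter_and (F := F) _ _ (H (e / 2) ltac:(lra)) (H' (e / 2) ltac:(lra))).
  intros n [h h'].
  replace (u n + v n - (l + m))%C with ((u n - l) + (v n - m))%C by ring.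
  apply Rle_lt_trans with (1 := Cmod_triangle _ _). lra.
Qed.

Lemma tends_scal (a : C) (u : nat -> C) (l : C) :
  tends F u l -> tends F (fun n => (a * u n)%C) (a * l)%C.
Proof.
  intros H e he. pose proof (Cmod_ge_0 a) as ha.
  assert (hq : 0 < e / (Cmod a + 1)) by (apply Rdiv_lt_0_compat; lra).
  apply filter_imp with (2 := H _ hq). intros n h.
  replace (a * u n - a * l)%C with (a * (u n - l))%C by ring.
  rewrite Cmod_mult.
  assert (e / (Cmod a + 1) * (Cmod a + 1) = e) by (field; lra).
  pose proof (Cmod_ge_0 (u n - l)). nra.
Qed.

Lemma tends_conj (u : nat -> C) (l : C) :
  tends F u l -> tends F (fun n => Cconj (u n)) (Cconj l).
Proof.
  intros H e he. apply filter_imp with (2 := H e he). intros n h.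
  replace (Cconj (u n) - Cconj l)%C with (Cconj (u n - l)).
  - now rewrite Cmod_conj.
  - destruct (u n), l; unfold Cconj, Cminus, Cplus, Copp; simpl; f_equal; ring.
Qed.

Lemma tends_Re_le (u : nat -> C) (l : C) (b : R) :
  (forall e, 0 < e -> F (fun n => Re (u n) <= b + e)) -> tends F u l -> Re l <= b.
Proof.
  intros H H'. apply Rle_plus_epsilon. intros e he.
  destruct (filter_ex (F := F) _
    (filter_and (F := F) _ _ (H (e / 2) ltac:(lra)) (H' (e / 2) ltac:(lra)))) as [n [h h']].
  pose proof (re_le_Cmod (u n - l)%C) as h2. apply Rabs_le_between in h2.
  change (Re (u n - l)) with (Re (u n) + - Re l) in h2. lra.
Qed.

Lemma tends_Re_ge (u : nat -> C) (l : C) (b : R) :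
  (forall e, 0 < e -> F (fun n => b - e <= Re (u n))) -> tends F u l -> b <= Re l.
Proof.
  intros H H'. apply Ropp_le_cancel.
  change (- Re l) with (Re (- l)).
  apply tends_Re_le with (u := fun n => (- u n)%C).
  - intros e he. apply filter_imp with (2 := H e he). intros n h.
    change (Re (- u n)) with (- Re (u n)). lra.
  - apply tends_ext with (fun n => (RtoC (-1) * u n)%C).
    + intros n. Cpair_ring.
    + replace (- l)%C with (RtoC (-1) * l)%C.
      * now apply tends_scal.
      * Cpair_ring.
Qed.

Lemma tends_Cmod_le (u : nat -> C) (l : C) (b : R) :
  (forall e, 0 < e -> F (fun n => Cmod (u n) <= b + e)) -> tends F u l -> Cmod l <= b.
Proof.
  intros H H'. apply Rle_plus_epsilon. intros e he.
  destruct (filter_ex (F := F) _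
    (filter_and (F := F) _ _ (H (e / 2) ltac:(lra)) (H' (e / 2) ltac:(lra)))) as [n [h h']].
  replace l with (u n + - (u n - l))%C by ring.
  apply Rle_trans with (1 := Cmod_triangle _ _). rewrite Cmod_opp. lra.
Qed.

End Tends.

Lemma Cmod_le_abs (c : C) : Cmod c <= Rabs (Re c) + Rabs (Im c).
Proof.
  assert (E : c = (RtoC (Re c) + Ci * RtoC (Im c))%C) by Cpair_ring.
  rewrite E at 1.
  apply Rle_trans with (1 := Cmod_triangle _ _).
  rewrite Cmod_mult, Cmod_Ci, !Cmod_R. lra.
Qed.

Lemma tends_cauchy (u : nat -> C) :
  (forall e, 0 < e -> exists N, forall n m, (N <= n)%nat -> (N <= m)%nat ->
     Cmod (u n - u m) < e) -> exists l, tends eventually u l.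
Proof.
  intros H.
  assert (HR : Cauchy_crit (fun n => Re (u n))).
  { intros e he. destruct (H e he) as [N hN]. exists N. intros n m hn hm.
    unfold Rdist. apply Rle_lt_trans with (2 := hN n m hn hm).
    exact (re_le_Cmod (u n - u m)%C). }
  assert (HI : Cauchy_crit (fun n => Im (u n))).
  { intros e he. destruct (H e he) as [N hN]. exists N. intros n m hn hm.
    unfold Rdist. apply Rle_lt_trans with (2 := hN n m hn hm).
    exact (Rle_trans _ _ _ (Rmax_r _ _) (Rmax_Cmod (u n - u m)%C)). }
  destruct (Rcomplete.R_complete _ HR) as [a ha]. destruct (Rcomplete.R_complete _ HI) as [b hb].
  exists (a, b). intros e he.
  destruct (ha (e / 2) ltac:(lra)) as [N hN]. destruct (hb (e / 2) ltac:(lra)) as [N' hN'].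
  exists (max N N'). intros n hn.
  apply Rle_lt_trans with (1 := Cmod_le_abs _).
  specialize (hN n ltac:(lia)). specialize (hN' n ltac:(lia)).
  unfold Rdist in *.
  change (Re (u n - (a, b))) with (Re (u n) - a).
  change (Im (u n - (a, b))) with (Im (u n) - b). lra.
Qed.

(** * Ultrafilter limits of bounded sequences *)

Definition ultra (F : (nat -> Prop) -> Prop) : Prop := forall P, F P \/ F (fun n => ~ P n).

(** Refining [eventually] makes the ultrafilter free: whatever holds from some index on is seen by
    its limits. *)
Lemma exists_ultrafilter : exists U : (nat -> Prop) -> Prop,
  ProperFilter U /\ (forall P, eventually P -> U P) /\ ultra U.
Proof.
  destruct (filter.ultraFilterLemma (T := nat) (F := Coquelicot.Hierarchy.eventually))
    as [U [HU hE]].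
  { split.
    - intros [N hN]. exact (hN N (le_n N)).
    - split.
      + exists 0%nat. intros n _. exact I.
      + intros A B. apply filter_and.
      + intros P Q h. apply filter_imp. exact h. }
  exists U. destruct (filter.ultra_proper (UltraFilter := HU)) as [h0 [hT hI hS]].
  split; [|split].
  - split.
    + intros P hP. apply NNPP. intros hn. apply h0.
      apply hS with (2 := hP). intros n hPn. apply hn. now exists n.
    + split; [exact hT|exact hI|]. intros P Q h. apply hS. exact h.
  - exact hE.
  - intros P. destruct (filter.in_ultra_setVsetC P HU) as [h|h]; [now left|now right].
Qed.

(** The limit is the supremum of the [r] with [r <= u n] on a set of the filter. The set where
    [l + e <= u n] cannot belong to the filter, so its complement does. *)
Lemma ultra_tends_R {F : (nat -> Prop) -> Prop} {FF : ProperFilter F} (UF : ultra F)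
  (u : nat -> R) (M : R) : (forall n, Rabs (u n) <= M) ->
  exists l, forall e, 0 < e -> F (fun n => Rabs (u n - l) < e).
Proof.
  intros hM.
  destruct (completeness (fun r => F (fun n => r <= u n))) as [l [hub hl]].
  - exists M. intros r hr. destruct (filter_ex _ hr) as [n hn].
    specialize (hM n). apply Rabs_le_between in hM. lra.
  - exists (- M). apply filter_forall. intros n.
    specialize (hM n). apply Rabs_le_between in hM. lra.
  - exists l. intros e he.
    assert (h1 : F (fun n => l - e < u n)).
    { apply NNPP. intros hn. assert (l <= l - e); [|lra]. apply hl. intros r hr.
      destruct (Rle_dec r (l - e)) as [h|h]; [easy|]. exfalso. apply hn.
      apply filter_imp with (2 := hr). intros; lra. }
    assert (h2 : F (fun n => ~ (l + e <= u n))).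
    { destruct (UF (fun n => l + e <= u n)) as [h|h]; [|easy].
      specialize (hub _ h). lra. }
    apply filter_imp with (2 := filter_and (F := F) _ _ h1 h2). intros n [h h'].
    apply Rabs_lt_between. lra.
Qed.

Lemma ultra_tends {F : (nat -> Prop) -> Prop} {FF : ProperFilter F} (UF : ultra F)
  (u : nat -> C) (M : R) : (forall n, Cmod (u n) <= M) -> exists l, tends F u l.
Proof.
  intros hM.
  destruct (ultra_tends_R UF (fun n => Re (u n)) M) as [a ha].
  { intros n. exact (Rle_trans _ _ _ (re_le_Cmod _) (hM n)). }
  destruct (ultra_tends_R UF (fun n => Im (u n)) M) as [b hb].
  { intros n. refine (Rle_trans _ _ _ _ (hM n)).
    exact (Rle_trans _ _ _ (Rmax_r _ _) (Rmax_Cmod (u n))). }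
  exists (a, b). intros e he.
  apply filter_imp with (2 := filter_and (F := F) _ _ (ha (e / 2) ltac:(lra)) (hb (e / 2) ltac:(lra))).
  intros n [h h']. apply Rle_lt_trans with (1 := Cmod_le_abs _).
  change (Re (u n - (a, b))) with (Re (u n) - a).
  change (Im (u n - (a, b))) with (Im (u n) - b). lra.
Qed.

Lemma inv_INR_small (e : R) :
  0 < e -> exists N, forall n, (N <= n)%nat -> / (INR n + 1) < e.
Proof.
  intros he. destruct (RinvN_cv he) as [N hN]. exists N. intros n hn.
  specialize (hN n hn). unfold Rdist in hN. simpl in hN. rewrite Rminus_0_r in hN.
  apply Rabs_lt_between in hN. lra.
Qed.

(** The [+ 1] keeps the tolerance [e / (a + 1)] meaningful for [a = 0]; the same device recurs
    throughout. *)
Lemma Rmult_lt_of_div (a x e : R) : 0 <= a -> 0 < e -> x < e / (a + 1) -> a * x < e.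
Proof.
  intros ha he hx.
  assert (hq : 0 < e / (a + 1)) by (apply Rdiv_lt_0_compat; lra).
  assert (E : e / (a + 1) * (a + 1) = e) by (field; lra).
  apply Rle_lt_trans with (a * (e / (a + 1))); [apply Rmult_le_compat_l|]; lra.
Qed.

(** * Positive semidefinite sesquilinear forms *)

(** No laws are asked of [add] and [scl], so that lists under [++], which form no vector space, can
    carry such a form just as vectors do. *)
Record psd_form {G : Type} (add : G -> G -> G) (scl : C -> G -> G) (ip : G -> G -> C) : Prop := {
  form_add_l : forall x y z, ip (add x y) z = (ip x z + ip y z)%C;
  form_scl_l : forall a x y, ip (scl a x) y = (a * ip x y)%C;
  form_conj : forall x y, ip y x = Cconj (ip x y);
  form_pos : forall x, 0 <= Re (ip x x)
}.

Definition seminorm {G : Type} (ip : G -> G -> C) (x : G) : R := sqrt (Re (ip x x)).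

Section Forms.

Context {G : Type} {add : G -> G -> G} {scl : C -> G -> G} {ip : G -> G -> C}.
Hypothesis Hf : psd_form add scl ip.

Lemma form_add_r (x y z : G) : ip z (add x y) = (ip z x + ip z y)%C.
Proof.
  rewrite (form_conj _ _ _ Hf), (form_add_l _ _ _ Hf), (form_conj _ _ _ Hf z x),
    (form_conj _ _ _ Hf z y).
  Cpair_ring.
Qed.

Lemma form_scl_r (a : C) (x y : G) : ip x (scl a y) = (Cconj a * ip x y)%C.
Proof.
  rewrite (form_conj _ _ _ Hf), (form_scl_l _ _ _ Hf), (form_conj _ _ _ Hf x y).
  Cpair_ring.
Qed.

Lemma form_diag (x : G) : ip x x = RtoC (Re (ip x x)).
Proof.
  pose proof (f_equal snd (form_conj _ _ _ Hf x x)) as h. simpl in h.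
  apply injective_projections; simpl; [reflexivity|lra].
Qed.

Lemma form_Re_sym (x y : G) : Re (ip y x) = Re (ip x y).
Proof. now rewrite (form_conj _ _ _ Hf x y). Qed.

Lemma form_Re_add (x y : G) :
  Re (ip (add x y) (add x y)) = Re (ip x x) + 2 * Re (ip x y) + Re (ip y y).
Proof.
  rewrite (form_add_l _ _ _ Hf), !form_add_r. simpl.
  change (fst ?z) with (Re z). rewrite (form_Re_sym x y). ring.
Qed.

Lemma form_Re_scl (a : C) (x : G) :
  Re (ip (scl a x) (scl a x)) = (Cmod a)² * Re (ip x x).
Proof.
  rewrite (form_scl_l _ _ _ Hf), form_scl_r, form_diag.
  unfold Rsqr, Cmod. rewrite sqrt_sqrt; [simpl; ring|nra].
Qed.

Lemma seminorm_ge_0 (x : G) : 0 <= seminorm ip x.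
Proof. apply sqrt_pos. Qed.

Lemma seminorm_sqr (x : G) : seminorm ip x * seminorm ip x = Re (ip x x).
Proof. apply sqrt_sqrt, (form_pos _ _ _ Hf). Qed.

Lemma seminorm_diag (x : G) : Cmod (ip x x) = seminorm ip x * seminorm ip x.
Proof.
  rewrite seminorm_sqr, form_diag, Cmod_R.
  apply Rabs_pos_eq, (form_pos _ _ _ Hf).
Qed.

(** Expand the square of [x - t w y] with [w = ip x y]. For [|y| > 0] take [t = 1/|y|^2]; if
    [|y| = 0], the expansion is affine in [t], and its nonnegativity for large [t] forces
    [w = 0]. *)
Lemma form_cauchy_schwarz (x y : G) : Cmod (ip x y) <= seminorm ip x * seminorm ip y.
Proof.
  unfold seminorm. rewrite <- sqrt_mult; try apply (form_pos _ _ _ Hf).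
  apply Rsqr_incr_0_var; [|apply sqrt_pos].
  rewrite Rsqr_sqrt; [|apply Rmult_le_pos; apply (form_pos _ _ _ Hf)].
  pose proof (form_pos _ _ _ Hf x) as hx. pose proof (form_pos _ _ _ Hf y) as hy.
  set (w := ip x y). set (W := (Cmod w)²).
  assert (hW : 0 <= W) by apply Rle_0_sqr.
  assert (key : forall t, 0 <= Re (ip x x) - 2 * t * W + t * t * W * Re (ip y y)).
  { intros t. pose proof (form_pos _ _ _ Hf (add x (scl (- (RtoC t * w))%C y))) as h.
    rewrite form_Re_add, form_Re_scl, form_scl_r in h. fold w in h.
    rewrite Cmod_opp, Cmod_mult, Cmod_R, Rsqr_mult, <- Rsqr_abs in h. fold W in h.
    replace (Re (Cconj (- (RtoC t * w)) * w)) with (- (t * W)) in h; [unfold Rsqr in h; lra|].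
    unfold W, Rsqr, Cmod. rewrite sqrt_sqrt; [simpl; ring|nra]. }
  destruct (Rle_lt_or_eq_dec _ _ hy) as [h|h].
  - specialize (key (/ Re (ip y y))).
    assert (E : / Re (ip y y) * Re (ip y y) = 1) by (field; lra).
    set (k := / Re (ip y y)) in *.
    replace (k * k * W * Re (ip y y)) with (k * W * (k * Re (ip y y))) in key by ring.
    rewrite E in key.
    replace W with (k * W * Re (ip y y)) by (rewrite <- (Rmult_1_r W) at 2; rewrite <- E; ring).
    apply Rmult_le_compat_r; lra.
  - rewrite <- h, Rmult_0_r. apply Rnot_lt_le. intros hp.
    specialize (key ((Re (ip x x) + 1) / (2 * W))). rewrite <- h in key.
    replace (2 * ((Re (ip x x) + 1) / (2 * W)) * W) with (Re (ip x x) + 1) in key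
      by (field; lra). lra.
Qed.

Lemma seminorm_add (x y : G) : seminorm ip (add x y) <= seminorm ip x + seminorm ip y.
Proof.
  pose proof (seminorm_ge_0 x). pose proof (seminorm_ge_0 y).
  apply Rsqr_incr_0_var; [|lra]. unfold Rsqr.
  rewrite seminorm_sqr, form_Re_add.
  pose proof (form_cauchy_schwarz x y). pose proof (re_le_Cmod (ip x y)) as h.
  apply Rabs_le_between in h. rewrite <- !seminorm_sqr. nra.
Qed.

Lemma seminorm_scl (a : C) (x : G) : seminorm ip (scl a x) = Cmod a * seminorm ip x.
Proof.
  unfold seminorm. rewrite form_Re_scl, sqrt_mult, sqrt_Rsqr; auto using Cmod_ge_0, Rle_0_sqr.
  apply (form_pos _ _ _ Hf).
Qed.

Definition fsub (x y : G) : G := add x (scl (- (1))%C y).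

Lemma form_sub_l (x y z : G) : ip (fsub x y) z = (ip x z - ip y z)%C.
Proof. unfold fsub. rewrite (form_add_l _ _ _ Hf), (form_scl_l _ _ _ Hf). ring. Qed.

Lemma form_sub_r (x y z : G) : ip z (fsub x y) = (ip z x - ip z y)%C.
Proof.
  unfold fsub. rewrite form_add_r, form_scl_r.
  Cpair_ring.
Qed.

Lemma seminorm_le_of_dual (x : G) (c : R) :
  0 <= c -> (forall y, Cmod (ip x y) <= c * seminorm ip y) -> seminorm ip x <= c.
Proof.
  intros hc H. specialize (H x). rewrite seminorm_diag in H.
  pose proof (seminorm_ge_0 x).
  destruct (Req_dec (seminorm ip x) 0) as [E|E]; [lra|].
  apply Rmult_le_reg_r with (seminorm ip x); lra.
Qed.

(** Asking for equal pairings instead of [x = add y z] makes this usable for formal sums, where such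
    equations between vectors fail. *)
Lemma seminorm_le_add_of_dual (x y z : G) :
  (forall w, ip x w = (ip y w + ip z w)%C) -> seminorm ip x <= seminorm ip y + seminorm ip z.
Proof.
  intros H. pose proof (seminorm_ge_0 y). pose proof (seminorm_ge_0 z).
  apply seminorm_le_of_dual; [lra|]. intros w. rewrite H.
  apply Rle_trans with (1 := Cmod_triangle _ _).
  pose proof (form_cauchy_schwarz y w). pose proof (form_cauchy_schwarz z w). lra.
Qed.

Lemma seminorm_sub_sym (x y : G) : seminorm ip (fsub x y) = seminorm ip (fsub y x).
Proof.
  unfold seminorm. rewrite !form_sub_l, !form_sub_r. do 2 f_equal. ring.
Qed.

Lemma seminorm_le_sub (x y : G) :
  seminorm ip x <= seminorm ip (fsub x y) + seminorm ip y.
Proof. apply seminorm_le_add_of_dual. intros w. rewrite form_sub_l. ring. Qed.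

Lemma form_Re_sub (x y : G) :
  Re (ip (fsub x y) (fsub x y)) = Re (ip x x) - 2 * Re (ip x y) + Re (ip y y).
Proof.
  rewrite form_sub_l, !form_sub_r. pose proof (form_Re_sym x y).
  unfold Re in *. simpl. lra.
Qed.

End Forms.

Arguments fsub {G} add scl x y.

Lemma Hilbert_form (H : Hilbert) : @psd_form H plus scal (inner H).
Proof.
  split.
  - apply inner_plus_l.
  - apply inner_scal_l.
  - apply inner_conj.
  - apply inner_pos.
Qed.

Lemma Hilbert_norm (H : Hilbert) (x : H) : norm x = seminorm (inner H) x.
Proof. apply inner_norm. Qed.

(** * Hilbert spaces from sequentially complete inner products *)

Section MakeHilbert.

Context {V : ModuleSpace C_Ring} {ip : V -> V -> C}.
Hypothesis Hf : @psd_form V plus scal ip.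
Hypothesis Hdef : forall x, ip x x = RtoC 0 -> x = zero.

Definition ip_ball (x : V) (e : R) (y : V) : Prop := seminorm ip (minus y x) < e.

Lemma seminorm_zero : seminorm ip zero = 0.
Proof.
  transitivity (seminorm ip (scal (RtoC 0 : C_Ring) (zero : V))).
  - f_equal. symmetry. apply (scal_zero_l (zero : V)).
  - rewrite (seminorm_scl Hf), Cmod_0. ring.
Qed.

Lemma seminorm_minus_sym (x y : V) : seminorm ip (minus y x) = seminorm ip (minus x y).
Proof.
  rewrite <- (opp_minus x y), <- scal_opp_one, (seminorm_scl Hf), <- Rmult_1_l.
  f_equal. exact Cmod_m1.
Qed.

Lemma seminorm_minus_triangle (x y z : V) :
  seminorm ip (minus z x) <= seminorm ip (minus y x) + seminorm ip (minus z y).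
Proof.
  rewrite (minus_trans y z x), Rplus_comm. apply (seminorm_add Hf).
Qed.

Lemma ip_ball_center (x : V) (e : posreal) : ip_ball x e x.
Proof. unfold ip_ball. rewrite minus_eq_zero.
  apply Rle_lt_trans with (1 := Req_le _ _ seminorm_zero), cond_pos.
Qed.

Lemma ip_ball_sym (x y : V) (e : R) : ip_ball x e y -> ip_ball y e x.
Proof. unfold ip_ball. now rewrite seminorm_minus_sym. Qed.

Lemma ip_ball_triangle (x y z : V) (e1 e2 : R) :
  ip_ball x e1 y -> ip_ball y e2 z -> ip_ball x (e1 + e2) z.
Proof.
  unfold ip_ball. intros h h'. pose proof (seminorm_minus_triangle x y z). lra.
Qed.

Hypothesis Hcompl : forall s : nat -> V,
  (forall e, 0 < e -> exists N, forall n m, (N <= n)%nat -> (N <= m)%nat ->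
     seminorm ip (minus (s n) (s m)) < e) ->
  exists l : V, forall e, 0 < e -> exists N, forall n, (N <= n)%nat -> seminorm ip (minus (s n) l) < e.

Definition ip_Uniform : UniformSpace :=
  UniformSpace.Pack V
    (UniformSpace.Mixin V zero ip_ball ip_ball_center ip_ball_sym ip_ball_triangle) V.

Definition ip_NormedAux : NormedModuleAux C_AbsRing :=
  NormedModuleAux.Pack C_AbsRing V
    (NormedModuleAux.Class C_AbsRing V (ModuleSpace.class C_Ring V) (UniformSpace.class ip_Uniform)) V.

Lemma seminorm_eq_zero (x : V) : seminorm ip x = 0 -> x = zero.
Proof.
  intros h. apply Hdef. rewrite (form_diag Hf), <- (seminorm_sqr Hf), h.
  f_equal; ring.
Qed.

Lemma seminorm_compat (x y : V) (eps : posreal) :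
  ip_ball x eps y -> seminorm ip (minus y x) < 1 * eps.
Proof. now rewrite Rmult_1_l. Qed.

Definition ip_Normed_mixin : NormedModule.mixin_of C_AbsRing ip_NormedAux :=
  NormedModule.Mixin C_AbsRing ip_NormedAux (seminorm ip) 1
    (seminorm_add Hf) (fun a x => Req_le _ _ (seminorm_scl Hf a x))
    (fun x y eps h => h) seminorm_compat seminorm_eq_zero.

(** A limit has to be assigned to every family of sets, so it is chosen by [epsilon], with a junk
    value on families that do not converge. *)
Definition ip_lim (F : (V -> Prop) -> Prop) : V :=
  epsilon (inhabits (zero : V)) (fun l => forall eps : posreal, F (ip_ball l eps)).

(** Sequences suffice: pick [s n] whose ball of radius [1/(n+1)] belongs to [F]. Any two of these
    balls meet, so [s] is Cauchy, and its limit is a limit of [F]. *)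
Lemma ip_complete (F : (ip_Uniform -> Prop) -> Prop) :
  ProperFilter F -> cauchy F -> forall eps : posreal, F (ball (ip_lim F : ip_Uniform) eps).
Proof.
  intros FF HF. unfold ip_lim. apply epsilon_spec.
  assert (hc : forall n : nat, exists x : V, F (ip_ball x (/ (INR n + 1)))).
  { intros n. exact (HF (mkposreal _ (RinvN_pos n))). }
  destruct (choice _ hc) as [s hs]. clear hc.
  destruct (Hcompl s) as [l hl].
  - intros e he. destruct (inv_INR_small (e / 2) ltac:(lra)) as [N hN]. exists N. intros n m hn hm.
    destruct (filter_ex _ (filter_and _ _ (hs n) (hs m))) as [x [h h']].
    pose proof (hN n hn). pose proof (hN m hm).
    unfold ip_ball in h, h'.
    pose proof (seminorm_minus_triangle (s m) x (s n)) as ht.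
    rewrite (seminorm_minus_sym x (s n)) in ht. lra.
  - exists l. intros eps.
    assert (he : 0 < eps / 2) by (pose proof (cond_pos eps); lra).
    destruct (inv_INR_small _ he) as [N hN]. destruct (hl _ he) as [N' hN'].
    specialize (hN (max N N') ltac:(lia)). specialize (hN' (max N N') ltac:(lia)).
    refine (filter_imp _ _ _ (hs (max N N'))).
    intros x hx. unfold ip_ball in *.
    pose proof (seminorm_minus_triangle l (s (max N N')) x). lra.
Qed.

Lemma ip_close_lim (F1 F2 : (ip_Uniform -> Prop) -> Prop) :
  filter_le F1 F2 -> filter_le F2 F1 -> close (ip_lim F1 : ip_Uniform) (ip_lim F2).
Proof.
  intros h h'.
  replace F2 with F1.
  - intros eps. apply ball_center.
  - apply functional_extensionality. intros P. apply propositional_extensionality.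
    split; [apply h'|apply h].
Qed.

Definition ip_CNM : CompleteNormedModule C_AbsRing :=
  CompleteNormedModule.Pack C_AbsRing V
    (CompleteNormedModule.Class C_AbsRing V
       (NormedModule.Class C_AbsRing V (NormedModuleAux.class C_AbsRing ip_NormedAux) ip_Normed_mixin)
       (CompleteSpace.Mixin ip_Uniform ip_lim ip_complete ip_close_lim)) V.

Definition make_Hilbert : Hilbert :=
  Build_Hilbert ip_CNM ip (form_add_l _ _ _ Hf) (form_scl_l _ _ _ Hf) (form_conj _ _ _ Hf)
    (form_pos _ _ _ Hf) Hdef (fun x => eq_refl).

End MakeHilbert.

Arguments make_Hilbert {V ip}.

(** * Hilbert space completion of a positive semidefinite form *)

Section Completion.

Context {G : Type} {add : G -> G -> G} {scl : C -> G -> G} {ip : G -> G -> C}.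
Hypothesis Hf : psd_form add scl ip.
Variable g0 : G.

Local Notation sub := (fsub add scl).
Local Notation nm := (seminorm ip).

(* A point of the completion is encoded as the functional [x |-> <s_n, x>] in the
   limit, so that equality and the module operations are pointwise. *)
Definition rep (f : G -> C) (s : nat -> G) : Prop :=
  forall e, 0 < e -> eventually (fun n => forall x, Cmod (f x - ip (s n) x) <= e * nm x).

Lemma rep_tends (f : G -> C) (s : nat -> G) (x : G) :
  rep f s -> tends eventually (fun n => ip (s n) x) (f x).
Proof.
  intros H e he. pose proof (seminorm_ge_0 (ip := ip) x) as hx.
  assert (hq : 0 < e / (nm x + 1)) by (apply Rdiv_lt_0_compat; lra).
  refine (filter_imp (F := eventually) _ _ _ (H _ hq)). intros n h. specialize (h x).
  replace (ip (s n) x - f x)%C with (- (f x - ip (s n) x))%C by ring. rewrite Cmod_opp.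
  assert (e / (nm x + 1) * (nm x + 1) = e) by (field; lra). nra.
Qed.

Lemma rep_add (f : G -> C) (s : nat -> G) (x y : G) :
  rep f s -> f (add x y) = (f x + f y)%C.
Proof.
  intros H. apply (tends_unique (F := eventually)) with (1 := rep_tends _ _ _ H).
  apply tends_ext with (fun n => (ip (s n) x + ip (s n) y)%C).
  - intros n. now rewrite (form_add_r Hf).
  - apply tends_plus; now apply rep_tends.
Qed.

Lemma rep_scl (f : G -> C) (s : nat -> G) (a : C) (x : G) :
  rep f s -> f (scl a x) = (Cconj a * f x)%C.
Proof.
  intros H. apply (tends_unique (F := eventually)) with (1 := rep_tends _ _ _ H).
  apply tends_ext with (fun n => (Cconj a * ip (s n) x)%C).
  - intros n. now rewrite (form_scl_r Hf).
  - apply tends_scal; now apply rep_tends.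
Qed.

Lemma rep_sub (f : G -> C) (s : nat -> G) (x y : G) :
  rep f s -> f (sub x y) = (f x - f y)%C.
Proof.
  intros H. unfold fsub. rewrite (rep_add _ _ _ _ H), (rep_scl _ _ _ _ H). Cpair_ring.
Qed.

Lemma rep_bound (f : G -> C) (s : nat -> G) :
  rep f s -> exists L, 0 <= L /\ forall x, Cmod (f x) <= L * nm x.
Proof.
  intros H. destruct (filter_ex _ (H 1 Rlt_0_1)) as [n hn].
  exists (1 + nm (s n)). pose proof (seminorm_ge_0 (ip := ip) (s n)). split; [lra|]. intros x.
  replace (f x) with ((f x - ip (s n) x) + ip (s n) x)%C by ring.
  apply Rle_trans with (1 := Cmod_triangle _ _).
  pose proof (hn x). pose proof (form_cauchy_schwarz Hf (s n) x). lra.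
Qed.

Lemma rep_seq_bound (f : G -> C) (s : nat -> G) :
  rep f s -> exists L, 0 <= L /\ eventually (fun n => nm (s n) <= L).
Proof.
  intros H. destruct (rep_bound _ _ H) as [L [hL h]]. exists (L + 1). split; [lra|].
  refine (filter_imp (F := eventually) _ _ _ (H 1 Rlt_0_1)). intros n hn.
  apply (seminorm_le_of_dual Hf); [lra|]. intros y.
  replace (ip (s n) y) with (f y + - (f y - ip (s n) y))%C by ring.
  apply Rle_trans with (1 := Cmod_triangle _ _). rewrite Cmod_opp.
  pose proof (hn y). pose proof (h y). lra.
Qed.

Lemma rep_close (f : G -> C) (s t : nat -> G) :
  rep f s -> rep f t -> forall e, 0 < e ->
  exists N, forall n m, (N <= n)%nat -> (N <= m)%nat -> nm (sub (s n) (t m)) <= e.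
Proof.
  intros Hs Ht e he.
  destruct (Hs (e / 2) ltac:(lra)) as [N hN]. destruct (Ht (e / 2) ltac:(lra)) as [N' hN'].
  exists (max N N'). intros n m hn hm. apply (seminorm_le_of_dual Hf); [lra|]. intros y.
  rewrite (form_sub_l Hf).
  replace (ip (s n) y - ip (t m) y)%C
    with ((f y - ip (t m) y) + - (f y - ip (s n) y))%C by ring.
  apply Rle_trans with (1 := Cmod_triangle _ _). rewrite Cmod_opp.
  pose proof (hN n ltac:(lia) y). pose proof (hN' m ltac:(lia) y). lra.
Qed.

(** The numbers [ip (s n) x] are Cauchy for each [x]; letting [m] tend to infinity in the Cauchy
    estimate gives the uniformity in [x] that [rep] demands. *)
Lemma rep_of_cauchy (s : nat -> G) :
  (forall e, 0 < e ->
     exists N, forall n m, (N <= n)%nat -> (N <= m)%nat -> nm (sub (s n) (s m)) <= e) ->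
  exists f, rep f s.
Proof.
  intros H.
  assert (hl : forall x, exists l, tends eventually (fun n => ip (s n) x) l).
  { intros x. apply tends_cauchy. intros e he. pose proof (seminorm_ge_0 (ip := ip) x) as hx.
    assert (hq : 0 < e / (nm x + 1)) by (apply Rdiv_lt_0_compat; lra).
    destruct (H _ hq) as [N hN]. exists N. intros n m hn hm.
    rewrite <- (form_sub_l Hf).
    pose proof (form_cauchy_schwarz Hf (sub (s n) (s m)) x). specialize (hN n m hn hm).
    assert (e / (nm x + 1) * (nm x + 1) = e) by (field; lra). nra. }
  destruct (choice _ hl) as [f hf]. exists f. intros e he.
  destruct (H e he) as [N hN]. exists N. intros n hn x.
  apply (tends_Cmod_le (F := eventually)) with (fun m => (ip (s m) x - ip (s n) x)%C).
  - intros e' he'. exists N. intros m hm. rewrite <- (form_sub_l Hf).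
    pose proof (form_cauchy_schwarz Hf (sub (s m) (s n)) x). specialize (hN m n hm hn).
    pose proof (seminorm_ge_0 (ip := ip) x). nra.
  - apply tends_ext with (fun m => (ip (s m) x + - ip (s n) x)%C); [reflexivity|].
    apply tends_plus; [apply hf|apply tends_const].
Qed.

Definition completion : Type := {f : G -> C | exists s, rep f s}.

Definition kev (f : completion) : G -> C := proj1_sig f.

Lemma completion_ext (f g : completion) : (forall x, kev f x = kev g x) -> f = g.
Proof.
  destruct f as [f hf], g as [g hg]. simpl. intros h.
  assert (E : f = g) by now apply functional_extensionality. subst g.
  f_equal. apply proof_irrelevance.
Qed.

Lemma rep_plus (f g : completion) : exists s, rep (fun x => (kev f x + kev g x)%C) s.
Proof.
  destruct f as [f [s hs]], g as [g [t ht]]. exists (fun n => add (s n) (t n)).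
  intros e he.
  refine (filter_imp (F := eventually) _ _ _
    (filter_and (F := eventually) _ _ (hs (e / 2) ltac:(lra)) (ht (e / 2) ltac:(lra)))).
  intros n [h h'] x. simpl. rewrite (form_add_l _ _ _ Hf).
  replace (f x + g x - (ip (s n) x + ip (t n) x))%C
    with ((f x - ip (s n) x) + (g x - ip (t n) x))%C by ring.
  apply Rle_trans with (1 := Cmod_triangle _ _). pose proof (h x). pose proof (h' x). lra.
Qed.

Lemma rep_scal (a : C) (f : completion) : exists s, rep (fun x => (a * kev f x)%C) s.
Proof.
  destruct f as [f [s hs]]. exists (fun n => scl a (s n)).
  intros e he. pose proof (Cmod_ge_0 a).
  assert (hq : 0 < e / (Cmod a + 1)) by (apply Rdiv_lt_0_compat; lra).
  refine (filter_imp (F := eventually) _ _ _ (hs _ hq)).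
  intros n h x. simpl. rewrite (form_scl_l _ _ _ Hf).
  replace (a * f x - a * ip (s n) x)%C with (a * (f x - ip (s n) x))%C by ring.
  rewrite Cmod_mult. specialize (h x).
  pose proof (seminorm_ge_0 (ip := ip) x). pose proof (Cmod_ge_0 (f x - ip (s n) x)).
  assert (e / (Cmod a + 1) * (Cmod a + 1) = e) by (field; lra).
  apply Rle_trans with ((Cmod a + 1) * (e / (Cmod a + 1) * nm x)); nra.
Qed.

Lemma rep_hat (z : G) : rep (ip z) (fun _ => z).
Proof.
  intros e he. apply filter_forall. intros _ x.
  replace (ip z x - ip z x)%C with (RtoC 0) by ring. rewrite Cmod_0.
  pose proof (seminorm_ge_0 (ip := ip) x). nra.
Qed.

Definition kplus (f g : completion) : completion := exist _ _ (rep_plus f g).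
Definition kscal (a : C) (f : completion) : completion := exist _ _ (rep_scal a f).
Definition hat (z : G) : completion := exist _ (ip z) (ex_intro _ _ (rep_hat z)).
Definition kopp (f : completion) : completion := kscal (- (1))%C f.
(** [G] comes without a zero; [g0] is some element to multiply by [0]. *)
Definition kzero : completion := kscal (RtoC 0) (hat g0).

Ltac kext := intros; apply completion_ext; intros; simpl; ring.

Definition completion_Monoid : AbelianMonoid.
Proof.
  refine (AbelianMonoid.Pack completion (AbelianMonoid.Mixin completion kplus kzero _ _ _)
    completion); kext.
Defined.

Definition completion_AbelianGroup : AbelianGroup.
Proof.
  refine (AbelianGroup.Pack completion (AbelianGroup.Class completion
    (AbelianMonoid.class completion_Monoid) (AbelianGroup.Mixin completion_Monoid kopp _))
    completion); kext.
Defined.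

Definition completion_Module : ModuleSpace C_Ring.
Proof.
  refine (ModuleSpace.Pack C_Ring completion (ModuleSpace.Class C_Ring completion
    (AbelianGroup.class completion_AbelianGroup)
    (ModuleSpace.Mixin C_Ring completion_AbelianGroup kscal _ _ _ _)) completion).
  all: intros; apply completion_ext; intros; simpl; unfold mult, plus, one; simpl; ring.
Defined.

(** Pairing with [g] means evaluating the functional of [f] along a sequence representing [g]. The
    limit is the same for all such sequences, because [f] is bounded and two of them come
    together. *)
Lemma kip_ex (f g : completion) :
  exists c, forall t, rep (kev g) t -> tends eventually (fun k => kev f (t k)) c.
Proof.
  destruct f as [f [s hs]], g as [g [t ht]]. simpl.
  destruct (rep_bound _ _ hs) as [L [hL hb]].
  assert (key : forall t' e, rep g t' -> 0 < e -> exists N, forall n m, (N <= n)%nat ->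
     (N <= m)%nat -> Cmod (f (t n) - f (t' m)) < e).
  { intros t' e ht' he.
    assert (hq : 0 < e / (L + 1)) by (apply Rdiv_lt_0_compat; lra).
    destruct (rep_close _ _ _ ht ht' _ hq) as [N hN]. exists N. intros n m hn hm.
    rewrite <- (rep_sub _ _ _ _ hs). apply Rle_lt_trans with (1 := hb _).
    specialize (hN n m hn hm).
    assert (e / (L + 1) * (L + 1) = e) by (field; lra).
    pose proof (seminorm_ge_0 (ip := ip) (sub (t n) (t' m))). nra. }
  destruct (tends_cauchy (fun k => f (t k))) as [c hc].
  { intros e he. exact (key t e ht he). }
  exists c. intros t' ht'. apply tends_close with (2 := hc). intros e he.
  destruct (key t' e ht' he) as [N hN]. exists N. intros n hn. now apply hN.
Qed.

Definition kip (f g : completion) : C :=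
  proj1_sig (constructive_indefinite_description _ (kip_ex f g)).

Lemma kip_spec (f g : completion) (t : nat -> G) :
  rep (kev g) t -> tends eventually (fun k => kev f (t k)) (kip f g).
Proof. unfold kip. destruct constructive_indefinite_description as [c hc]. apply hc. Qed.

Lemma kip_tends (f g : completion) (s t : nat -> G) :
  rep (kev f) s -> rep (kev g) t -> tends eventually (fun k => ip (s k) (t k)) (kip f g).
Proof.
  intros hs ht. apply tends_close with (2 := kip_spec f g t ht). intros e he.
  destruct (rep_seq_bound _ _ ht) as [L [hL hb]].
  assert (hq : 0 < e / (L + 1)) by (apply Rdiv_lt_0_compat; lra).
  refine (filter_imp (F := eventually) _ _ _ (filter_and (F := eventually) _ _ hb (hs _ hq))).
  intros n [h h'].
  apply Rle_lt_trans with (1 := h' (t n)).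
  assert (e / (L + 1) * (L + 1) = e) by (field; lra). nra.
Qed.

Lemma completion_form : psd_form kplus kscal kip.
Proof.
  split.
  - intros f g h. destruct (proj2_sig h) as [t ht].
    apply (tends_unique (F := eventually)) with (1 := kip_spec _ _ t ht).
    apply (tends_plus (F := eventually) (fun k => kev f (t k)) (fun k => kev g (t k)));
      now apply kip_spec.
  - intros a f h. destruct (proj2_sig h) as [t ht].
    apply (tends_unique (F := eventually)) with (1 := kip_spec _ _ t ht).
    apply (tends_scal (F := eventually) a (fun k => kev f (t k))); now apply kip_spec.
  - intros f g. destruct (proj2_sig f) as [s hs], (proj2_sig g) as [t ht].
    apply (tends_unique (F := eventually)) with (1 := kip_tends _ _ _ _ ht hs).
    apply tends_ext with (2 := tends_conj _ _ (kip_tends _ _ _ _ hs ht)).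
    intros n. symmetry. apply (form_conj _ _ _ Hf).
  - intros f. destruct (proj2_sig f) as [s hs].
    apply (tends_Re_ge (F := eventually)) with (2 := kip_tends _ _ _ _ hs hs).
    intros e he. apply filter_forall. intros n.
    pose proof (form_pos _ _ _ Hf (s n)). lra.
Qed.

Lemma rep_seminorm_le (f : completion) (s : nat -> G) : rep (kev f) s ->
  forall e, 0 < e -> eventually (fun n => nm (s n) <= seminorm kip f + e).
Proof.
  intros hs e he. pose proof (seminorm_ge_0 (ip := kip) f).
  refine (filter_imp (F := eventually) _ _ _ (kip_tends _ _ _ _ hs hs (e * e) _)); [|nra].
  intros n h. pose proof (re_le_Cmod (ip (s n) (s n) - kip f f)%C) as h'.
  apply Rabs_le_between in h'.
  change (Re (ip (s n) (s n) - kip f f)) with (Re (ip (s n) (s n)) - Re (kip f f)) in h'.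
  rewrite <- (seminorm_sqr Hf), <- (seminorm_sqr completion_form) in h'.
  apply Rsqr_incr_0_var; unfold Rsqr; nra.
Qed.

(** With [kip_seminorm_le] this identifies the norm of [f] with its norm as a functional on [G], so
    that norms in the completion can be estimated pointwise. *)
Lemma app_le (f : completion) (x : G) : Cmod (kev f x) <= seminorm kip f * nm x.
Proof.
  destruct (proj2_sig f) as [s hs]. pose proof (seminorm_ge_0 (ip := ip) x).
  apply (tends_Cmod_le (F := eventually)) with (2 := rep_tends _ _ x hs). intros e he.
  assert (hq : 0 < e / (nm x + 1)) by (apply Rdiv_lt_0_compat; lra).
  refine (filter_imp (F := eventually) _ _ _ (rep_seminorm_le _ _ hs _ hq)). intros n h.
  apply Rle_trans with (1 := form_cauchy_schwarz Hf _ _).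
  assert (e / (nm x + 1) * (nm x + 1) = e) by (field; lra). nra.
Qed.

Lemma kip_seminorm_le (f : completion) (c : R) : 0 <= c ->
  (forall x, Cmod (kev f x) <= c * nm x) -> seminorm kip f <= c.
Proof.
  intros hc H. apply (seminorm_le_of_dual completion_form); [easy|]. intros g.
  destruct (proj2_sig g) as [t ht].
  apply (tends_Cmod_le (F := eventually)) with (2 := kip_spec f g t ht). intros e he.
  assert (hq : 0 < e / (c + 1)) by (apply Rdiv_lt_0_compat; lra).
  refine (filter_imp (F := eventually) _ _ _ (rep_seminorm_le _ _ ht _ hq)). intros n h.
  apply Rle_trans with (1 := H _).
  assert (e / (c + 1) * (c + 1) = e) by (field; lra). nra.
Qed.

Lemma kip_hat_r (f : completion) (z : G) : kip f (hat z) = kev f z.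
Proof.
  apply (tends_unique (F := eventually)) with (1 := kip_spec f (hat z) _ (rep_hat z)).
  apply tends_const.
Qed.

Lemma kip_hat (z w : G) : kip (hat z) (hat w) = ip z w.
Proof. now rewrite kip_hat_r. Qed.

Lemma hat_dense (f : completion) (e : R) :
  0 < e -> exists z, forall x, Cmod (kev f x - ip z x) <= e * nm x.
Proof.
  intros he. destruct (proj2_sig f) as [s hs].
  destruct (filter_ex _ (hs e he)) as [n hn]. now exists (s n).
Qed.

Lemma kip_definite (f : completion) : kip f f = RtoC 0 -> f = kzero.
Proof.
  intros h. apply completion_ext. intros x. simpl.
  pose proof (app_le f x) as hx. unfold seminorm at 1 in hx. rewrite h in hx.
  simpl in hx. rewrite sqrt_0, Rmult_0_l in hx.
  rewrite Cmult_0_l. apply Cmod_eq_0. pose proof (Cmod_ge_0 (kev f x)). lra.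
Qed.

(** Diagonal argument: [u n] is within [1/(n+1)] of some [hat (z n)]; the [z n] are Cauchy, and the
    functional that they represent is the limit. *)
Lemma completion_complete (u : nat -> completion_Module) :
  (forall e, 0 < e -> exists N, forall n m, (N <= n)%nat -> (N <= m)%nat ->
     seminorm kip (minus (u n) (u m)) < e) ->
  exists l : completion_Module, forall e, 0 < e -> exists N, forall n, (N <= n)%nat ->
     seminorm kip (minus (u n) l) < e.
Proof.
  intros H.
  assert (hz : forall n : nat, exists z, forall x,
    Cmod (kev (u n) x - ip z x) <= / (INR n + 1) * nm x).
  { intros n. apply hat_dense, RinvN_pos. }
  destruct (choice _ hz) as [z hz']. clear hz.
  assert (app_minus : forall (f g : completion_Module) x,
    kev (minus f g) x = (kev f x - kev g x)%C).
  { intros. unfold minus, plus, opp. simpl. ring. }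
  destruct (rep_of_cauchy z) as [f hf].
  - intros e he. destruct (H (e / 3) ltac:(lra)) as [N hN].
    destruct (inv_INR_small (e / 3) ltac:(lra)) as [N' hN']. exists (max N N'). intros n m hn hm.
    apply (seminorm_le_of_dual Hf); [lra|]. intros x. rewrite (form_sub_l Hf).
    replace (ip (z n) x - ip (z m) x)%C with
      (- (kev (u n) x - ip (z n) x) + ((kev (u n) x - kev (u m) x) + (kev (u m) x - ip (z m) x)))%C
      by ring.
    apply Rle_trans with (1 := Cmod_triangle _ _). rewrite Cmod_opp.
    pose proof (Cmod_triangle (kev (u n) x - kev (u m) x) (kev (u m) x - ip (z m) x)).
    rewrite <- app_minus in *. pose proof (app_le (minus (u n) (u m)) x).
    pose proof (hz' n x). pose proof (hz' m x).
    specialize (hN n m ltac:(lia) ltac:(lia)).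
    pose proof (hN' n ltac:(lia)). pose proof (hN' m ltac:(lia)).
    pose proof (seminorm_ge_0 (ip := ip) x). nra.
  - set (l := (exist _ f (ex_intro _ z hf) : completion)).
    exists l. intros e he.
    destruct (hf (e / 3) ltac:(lra)) as [N hN].
    destruct (inv_INR_small (e / 3) ltac:(lra)) as [N' hN']. exists (max N N'). intros n hn.
    apply Rle_lt_trans with (2 * (e / 3)); [|lra].
    apply kip_seminorm_le; [lra|]. intros x. rewrite app_minus. simpl.
    replace (kev (u n) x - f x)%C with
      ((kev (u n) x - ip (z n) x) + - (f x - ip (z n) x))%C by ring.
    apply Rle_trans with (1 := Cmod_triangle _ _). rewrite Cmod_opp.
    pose proof (hz' n x). pose proof (hN n ltac:(lia) x). pose proof (hN' n ltac:(lia)).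
    pose proof (seminorm_ge_0 (ip := ip) x). nra.
Qed.

Definition completion_Hilbert : Hilbert :=
  @make_Hilbert completion_Module kip completion_form kip_definite completion_complete.

End Completion.

(** * Bounded operators *)

Lemma minus_plus_l {G : AbelianGroup} (x w : G) : minus (plus x w) x = w.
Proof.
  transitivity (plus w (minus x x)).
  - unfold minus. now rewrite (plus_comm x), <- plus_assoc.
  - exact (eq_trans (f_equal (plus w) (minus_eq_zero x)) (plus_zero_r w)).
Qed.
Lemma minus_minus_l {G : AbelianGroup} (x w : G) : minus (minus x w) x = opp w.
Proof. exact (minus_plus_l x (opp w)). Qed.
Lemma minus_plus_minus {G : AbelianGroup} (x w : G) :
  minus (plus x w) (minus x w) = plus w w.
Proof.
  rewrite (minus_trans x).
  apply f_equal2; [apply minus_plus_l|].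
  rewrite <- opp_minus.
  exact (eq_trans (f_equal opp (minus_minus_l x w)) (opp_opp w)).
Qed.

Lemma norm_scal_C {V : NormedModule C_AbsRing} (a : C) (x : V) :
  norm (scal a x) <= Cmod a * norm x.
Proof. exact (norm_scal a x). Qed.

Lemma norm_minus_le {V : NormedModule C_AbsRing} (x y : V) :
  norm (minus x y) <= norm x + norm y.
Proof. rewrite <- (norm_opp y). apply (norm_triangle x (opp y)). Qed.

Lemma norm_minus_self {V : NormedModule C_AbsRing} (x : V) : norm (minus x x) = 0.
Proof. exact (eq_trans (f_equal norm (minus_eq_zero x)) norm_zero). Qed.

Lemma norm_minus_sym {V : NormedModule C_AbsRing} (x y : V) :
  norm (minus x y) = norm (minus y x).
Proof. exact (eq_trans (eq_sym (norm_opp _)) (f_equal norm (opp_minus x y))). Qed.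

Lemma norm_minus_triangle {V : NormedModule C_AbsRing} (y x z : V) :
  norm (minus x z) <= norm (minus x y) + norm (minus y z).
Proof. rewrite (minus_trans y x z). apply norm_triangle. Qed.

Section Operators.

Context {U V : NormedModule C_AbsRing}.

Lemma bounded_linear_minus (f : U -> V) (x y : U) :
  bounded_linear f -> f (minus x y) = minus (f x) (f y).
Proof.
  intros [hp [hs _]]. unfold minus. rewrite hp. f_equal.
  transitivity (f (scal (opp one) y)).
  - f_equal. symmetry. apply (scal_opp_one y).
  - rewrite hs. apply (scal_opp_one (f y)).
Qed.

Lemma opnorm_finite (f : U -> V) : bounded_linear f ->
  exists L, opnorm f = Finite L /\ 0 <= L /\ (forall x, norm (f x) <= L * norm x) /\
    (forall e, 0 < e -> exists u, norm u <= 1 /\ L - e < norm (f u)).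
Proof.
  intros [hp [hs [M hM]]].
  destruct (Lub_Rbar_correct (fun r => exists x : U, norm x <= 1 /\ r = norm (f x)))
    as [hub hl].
  assert (hM' : 0 <= Rabs M) by apply Rabs_pos.
  assert (hfM : Rbar_le (opnorm f) (Rabs M)).
  { apply hl. intros r [x [hx ->]]. simpl.
    apply Rle_trans with (1 := hM x). pose proof (norm_ge_0 x). pose proof (Rle_abs M). nra. }
  assert (hf0 : Rbar_le 0 (opnorm f)).
  { apply Rbar_le_trans with (norm (f zero)); [apply norm_ge_0|].
    apply hub. exists zero. split; [|easy]. rewrite norm_zero. lra. }
  fold (opnorm f) in hub, hl.
  destruct (opnorm f) as [L| |] eqn:E; try easy.
  exists L. split; [easy|split; [easy|split]].
  - intros x. destruct (Rle_lt_or_eq_dec _ _ (norm_ge_0 x)) as [h|h].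
    + assert (hi : Cmod (RtoC (/ norm x)) = / norm x).
      { rewrite Cmod_R. apply Rabs_pos_eq. left. now apply Rinv_0_lt_compat. }
      assert (hu : norm (f (scal (RtoC (/ norm x)) x)) <= L).
      { apply (hub (norm (f (scal (RtoC (/ norm x)) x)))).
        eexists; split; [|reflexivity].
        apply Rle_trans with (1 := norm_scal_C _ _).
        rewrite hi. right. field. lra. }
      replace (f x) with (scal (RtoC (norm x)) (f (scal (RtoC (/ norm x)) x))).
      * apply Rle_trans with (1 := norm_scal_C _ _).
        rewrite Cmod_R, Rabs_pos_eq by lra. nra.
      * rewrite <- hs, scal_assoc.
        replace (mult (RtoC (norm x) : C_Ring) (RtoC (/ norm x))) with (one : C_Ring).
        -- f_equal. exact (scal_one x).
        -- apply injective_projections; simpl; field; lra.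
    + pose proof (hM x). rewrite <- h in *. pose proof (norm_ge_0 (f x)). lra.
  - intros e he. apply NNPP. intros hn.
    assert (hle : Rbar_le L (L - e)); [|simpl in hle; lra].
    apply hl. intros r [x [hx ->]]. simpl. apply Rnot_lt_le. intros hlt.
    apply hn. now exists x.
Qed.

Lemma opnorm_le (f : U -> V) (c : R) : 0 <= c -> (forall x, norm (f x) <= c * norm x) ->
  Rbar_le (opnorm f) c.
Proof.
  intros hc h. apply (Lub_Rbar_correct (fun r => exists x : U, norm x <= 1 /\ r = norm (f x))).
  intros r [x [hx ->]]. simpl. apply Rle_trans with (1 := h x).
  pose proof (norm_ge_0 x). nra.
Qed.

End Operators.

(** * Sequential completeness and the uniform boundedness principle *)

Definition seq_complete (V : NormedModule C_AbsRing) : Prop := forall s : nat -> V,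
  (forall e, 0 < e -> exists N, forall n m, (N <= n)%nat -> (N <= m)%nat ->
     norm (minus (s n) (s m)) < e) ->
  exists l : V, forall e, 0 < e -> eventually (fun n => norm (minus (s n) l) < e).

Lemma norm_cauchy_limit (V : CompleteNormedModule C_AbsRing) : seq_complete V.
Proof.
  intros s H. exists (lim (filtermap s eventually)).
  assert (hl : filterlim s eventually (locally (lim (filtermap s eventually)))).
  { apply (filterlim_locally s (lim (filtermap s eventually))). intros eps.
    apply (complete_cauchy (filtermap s eventually)).
    - apply filtermap_proper_filter, eventually_filter.
    - intros e. destruct (H e (cond_pos e)) as [N hN]. exists (s N). exists N.
      intros n hn. exact (norm_compat1 (s N) (s n) e (hN n N hn (le_n N))). }
  intros e he.
  exact (proj1 (filterlim_locally_ball_norm s _) hl (mkposreal e he)).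
Qed.

(* Sokal's gliding hump: at step [n] move by [3^-n] in a direction nearly norming an
   operator of norm at least [4^n]; the later steps cannot undo the growth. *)
Lemma uniform_boundedness {H V : NormedModule C_AbsRing} (f : nat -> H -> V) :
  seq_complete H -> (forall n, bounded_linear (f n)) ->
  (forall x, exists M, forall n, norm (f n x) <= M) ->
  exists L, forall n x, norm (f n x) <= L * norm x.
Proof.
  intros HC hf hb. apply NNPP. intros hn.
  assert (hk : forall n : nat, exists p : nat * H, exists L,
    (forall x, norm (f (fst p) x) <= L * norm x) /\ 4 ^ n <= L /\
    norm (snd p) <= 1 /\ 9 / 10 * L <= norm (f (fst p) (snd p))).
  { intros n. apply NNPP. intros hn'. apply hn. exists (4 ^ n). intros k.
    destruct (opnorm_finite (f k) (hf k)) as [L [_ [hL [hx hu]]]]. intros x.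
    apply Rle_trans with (1 := hx x). apply Rmult_le_compat_r; [apply norm_ge_0|].
    apply Rnot_lt_le. intros hlt. apply hn'.
    assert (0 < 4 ^ n) by (apply pow_lt; lra).
    destruct (hu (L / 10) ltac:(lra)) as [u [hu1 hu2]].
    exists (k, u), L. simpl. repeat split; auto; lra. }
  destruct (choice _ hk) as [p hp]. clear hk.
  set (g := fun n => f (fst (p n))). set (u := fun n => snd (p n)).
  set (step := fun n (x : H) => if Rle_dec (norm (g n (minus x (scal (RtoC ((/ 3) ^ n)) (u n)))))
                                     (norm (g n (plus x (scal (RtoC ((/ 3) ^ n)) (u n)))))
    then plus x (scal (RtoC ((/ 3) ^ n)) (u n)) else minus x (scal (RtoC ((/ 3) ^ n)) (u n))).
  set (x := fix x n : H := match n with O => zero | S n => step n (x n) end).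
  assert (hr : forall n, 0 < (/ 3) ^ n) by (intros; apply pow_lt; lra).
  assert (hd : forall n, norm (scal (RtoC ((/ 3) ^ n)) (u n)) <= (/ 3) ^ n).
  { intros n. apply Rle_trans with (1 := norm_scal_C (V := H) _ _).
    rewrite Cmod_R, Rabs_pos_eq by (left; apply hr).
    destruct (hp n) as [L [_ [_ [h _]]]]. specialize (hr n). unfold u. nra. }
  assert (hstep : forall n, norm (minus (x (S n)) (x n)) <= (/ 3) ^ n).
  { intros n. change (x (S n)) with (step n (x n)). unfold step.
    destruct Rle_dec.
    - apply Rle_trans with (2 := hd n), Req_le, f_equal.
      exact (minus_plus_l (G := NormedModule.AbelianGroup _ H) (x n) _).
    - apply Rle_trans with (2 := hd n), Req_le.
      refine (eq_trans _ (norm_opp (V := H) (scal (RtoC ((/ 3) ^ n)) (u n)))).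
      apply f_equal. exact (minus_minus_l (G := NormedModule.AbelianGroup _ H) (x n) _). }
  (* All moves from step [n] on have total length at most [3/2 * 3^-n]; the factor [1 - 3^-k] is the
     exact partial geometric sum, which lets the induction close. *)
  assert (hdist : forall n k, norm (minus (x (n + k)%nat) (x n)) <= 3 / 2 * (/ 3) ^ n * (1 - (/ 3) ^ k)).
  { intros n k. induction k as [|k IH].
    - rewrite Nat.add_0_r, norm_minus_self. simpl. lra.
    - rewrite Nat.add_succ_r.
      apply Rle_trans with (1 := norm_minus_triangle (x (n + k)%nat) _ _).
      pose proof (hstep (n + k)%nat) as h. rewrite pow_add in h.
      change ((/ 3) ^ S k) with (/ 3 * (/ 3) ^ k).
      pose proof (hr n). pose proof (hr k). nra. }
  assert (hdist' : forall n m, (n <= m)%nat -> norm (minus (x m) (x n)) <= 3 / 2 * (/ 3) ^ n).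
  { intros n m hm. replace m with (n + (m - n))%nat by lia.
    apply Rle_trans with (1 := hdist _ _). pose proof (hr n). pose proof (hr (m - n)%nat). nra. }
  destruct (HC x) as [l hl].
  { intros e he.
    destruct (pow_lt_1_zero (/ 3)) with (y := e / 4) as [N hN]; [rewrite Rabs_pos_eq; lra|lra|].
    exists N. intros n m hn' hm. specialize (hN N (le_n N)).
    rewrite Rabs_pos_eq in hN by (left; apply hr).
    apply Rle_lt_trans with (1 := norm_minus_triangle (x N) _ _).
    rewrite (norm_minus_sym (x N)).
    pose proof (hdist' N n hn'). pose proof (hdist' N m hm). lra. }
  assert (hlx : forall n, norm (minus l (x n)) <= 3 / 2 * (/ 3) ^ n).
  { intros n. apply Rle_plus_epsilon. intros e he.
    destruct (hl e he) as [N hN]. specialize (hN (max N n) ltac:(lia)).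
    apply Rle_trans with (1 := norm_minus_triangle (x (max N n)) _ _).
    rewrite (norm_minus_sym l).
    pose proof (hdist' n (max N n) ltac:(lia)). lra. }
  destruct (hb l) as [M hM].
  (* The moves after step [n] cost at most [1/2 * 3^-n * L] against a gain of [9/10 * 3^-n * L];
     this leaves [2/5 * 3^-n * L], and [L >= 4^n]. *)
  assert (hgrow : forall n, 2 / 5 * (4 / 3) ^ n <= M).
  { intros n. apply Rle_trans with (2 := hM (fst (p n))). fold (g n).
    destruct (hp n) as [L [hL [hL4 [_ hgu]]]]. fold (g n) (u n) in hL, hgu.
    assert (hg : bounded_linear (g n)) by apply hf.
    (* The two candidates for [x (S n)] differ by [2 * 3^-n * u n], so the larger of their images
       has norm at least [3^-n * norm (g n (u n))]; [step] selects that one. *)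
    assert (h1 : (/ 3) ^ n * (9 / 10 * L) <= norm (g n (x (S n)))).
    { assert (h2 : 2 * ((/ 3) ^ n * norm (g n (u n))) <=
        norm (g n (plus (x n) (scal (RtoC ((/ 3) ^ n)) (u n)))) +
        norm (g n (minus (x n) (scal (RtoC ((/ 3) ^ n)) (u n))))).
      { set (w := scal (RtoC ((/ 3) ^ n)) (u n)).
        assert (h3 : 3 ^ n * (/ 3) ^ n = 1)
          by (rewrite <- Rpow_mult_distr; replace (3 * / 3) with 1 by field; apply pow1).
        assert (E : g n (u n) = scal (RtoC (3 ^ n / 2))
          (minus (g n (plus (x n) w)) (g n (minus (x n) w)))).
        { rewrite <- bounded_linear_minus by easy. destruct hg as [hp' [hs' _]].
          rewrite <- hs'. f_equal.
          transitivity (scal (RtoC (3 ^ n / 2)) (plus w w)); [|apply f_equal, eq_sym;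
            exact (minus_plus_minus (G := NormedModule.AbelianGroup _ H) (x n) w)].
          unfold w. rewrite <- scal_distr_r, scal_assoc.
          replace (mult (RtoC (3 ^ n / 2) : C_Ring)
                     (plus (RtoC ((/ 3) ^ n) : C_Ring) (RtoC ((/ 3) ^ n))))
            with (one : C_Ring); [exact (eq_sym (scal_one (u n)))|].
          apply injective_projections; simpl; [|ring].
          replace (3 ^ n / 2 * ((/ 3) ^ n + (/ 3) ^ n) - 0 * (0 + 0)) with (3 ^ n * (/ 3) ^ n) by field.
          now rewrite h3. }
        pose proof (norm_scal_C (RtoC (3 ^ n / 2))
          (minus (g n (plus (x n) w)) (g n (minus (x n) w)))) as h4.
        rewrite <- E in h4.
        assert (h5 : 0 < 3 ^ n) by (apply pow_lt; lra).
        rewrite Cmod_R, Rabs_pos_eq in h4 by lra.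
        pose proof (norm_minus_le (g n (plus (x n) w)) (g n (minus (x n) w))) as h6.
        specialize (hr n).
        set (N := norm (minus (g n (plus (x n) w)) (g n (minus (x n) w)))) in *.
        apply Rle_trans with (2 := h6).
        apply Rle_trans with (2 * ((/ 3) ^ n * (3 ^ n / 2 * N))); [nra|].
        right. transitivity (3 ^ n * (/ 3) ^ n * N); [field|rewrite h3; ring]. }
      pose proof (hr n).
      change (x (S n)) with (step n (x n)). unfold step. destruct Rle_dec; nra. }
    pose proof (hlx (S n)) as h2.
    pose proof (hL (minus l (x (S n)))) as h3.
    rewrite bounded_linear_minus in h3 by easy.
    pose proof (norm_triangle_inv (g n (x (S n))) (g n l)) as h4.
    rewrite (norm_minus_sym (g n (x (S n)))) in h4. apply Rabs_le_between in h4.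
    assert (h5 : 4 ^ n * (/ 3) ^ n = (4 / 3) ^ n) by (rewrite <- Rpow_mult_distr; f_equal).
    rewrite <- h5. pose proof (hr n).
    change ((/ 3) ^ S n) with (/ 3 * (/ 3) ^ n) in h2.
    assert (0 < 4 ^ n) by (apply pow_lt; lra).
    assert (L * norm (minus l (x (S n))) <= L * (1 / 2 * (/ 3) ^ n))
      by (apply Rmult_le_compat_l; lra).
    nra. }
  destruct (archimed_cor1 (/ (1 + Rabs M))) as [N [hN hN0]].
  { apply Rinv_0_lt_compat. pose proof (Rabs_pos M). lra. }
  assert (hM1 : 1 + Rabs M < INR N).
  { pose proof (Rabs_pos M). assert (0 < INR N) by (apply lt_0_INR; lia).
    rewrite <- (Rinv_inv (1 + Rabs M)), <- (Rinv_inv (INR N)).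
    apply Rinv_lt_contravar; [apply Rmult_lt_0_compat; apply Rinv_0_lt_compat; lra|easy]. }
  (* Bernoulli's inequality gives [(4/3)^(9N) >= 1 + 3N], and [2/5 * (1 + 3N)] exceeds [N], hence
     [M]. *)
  specialize (hgrow (9 * N)%nat).
  pose proof (poly (9 * N) (1 / 3) ltac:(lra)) as hpoly.
  replace (1 + 1 / 3) with (4 / 3) in hpoly by field.
  rewrite mult_INR in hpoly. simpl (INR 9) in hpoly.
  pose proof (Rle_abs M). pose proof (Rabs_pos M). lra.
Qed.

Lemma Hilbert_sub (H : Hilbert) (x y : H) : minus x y = @fsub H plus scal x y.
Proof. symmetry. exact (f_equal (plus x) (scal_opp_one y)). Qed.

Lemma Hilbert_complete (H : Hilbert) (s : nat -> H) :
  (forall e, 0 < e -> exists N, forall n m, (N <= n)%nat -> (N <= m)%nat ->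
     seminorm (inner H) (@fsub H plus scal (s n) (s m)) < e) ->
  exists l, forall e, 0 < e ->
    eventually (fun n => seminorm (inner H) (@fsub H plus scal (s n) l) < e).
Proof.
  intros h. destruct (norm_cauchy_limit H s) as [l hl].
  - intros e he. destruct (h e he) as [N hN]. exists N. intros n m hn hm.
    change (norm (minus (s n) (s m) : H) < e). rewrite Hilbert_norm, Hilbert_sub. auto.
  - exists l. intros e he. refine (filter_imp (F := eventually) _ _ _ (hl e he)). intros n hn.
    rewrite <- Hilbert_sub, <- Hilbert_norm. exact hn.
Qed.

(** * Extension of a bounded linear graph by orthogonal projection *)

Section Extension.

Context {K H : Hilbert} {S : K -> H -> Prop} {c : R}.
Hypothesis hc : 0 <= c.
Hypothesis S_ne : exists k h, S k h.
Hypothesis S_add : forall k h k' h', S k h -> S k' h' -> S (plus k k') (plus h h').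
Hypothesis S_scl : forall a k h, S k h -> S (scal a k) (scal a h).
Hypothesis S_bound : forall k h, S k h -> seminorm (inner H) h <= c * seminorm (inner K) k.

Local Notation nK := (seminorm (inner K)).
Local Notation nH := (seminorm (inner H)).
Local Notation "x -- y" := (@fsub (CompleteNormedModule.sort C_AbsRing (hspace _)) plus scal x y)
    (at level 50, left associativity).
Local Notation fK := (Hilbert_form K).
Local Notation fH := (Hilbert_form H).

Lemma S_sub k h k' h' : S k h -> S k' h' -> S (k -- k') (h -- h').
Proof. intros h1 h2. apply S_add; auto. Qed.

(* [v] is the value at the orthogonal projection [p] of [k] on the closed domain of [S]
   of the closure of [S]. *)
Definition proj_value (k : K) (v : H) : Prop := exists p : K,
  (forall e, 0 < e -> exists s h, S s h /\ nK (p -- s) < e /\ nH (v -- h) < e) /\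
  (forall s h, S s h -> inner K (k -- p) s = RtoC 0).

Lemma proj_value_S k h : S k h -> proj_value k h.
Proof.
  intros hS. exists k. split.
  - intros e he. exists k, h. split; [easy|].
    split.
    + unfold seminorm. rewrite (form_sub_l fK), !(form_sub_r fK).
      match goal with |- sqrt (Re ?z) < _ => replace z with (RtoC 0) by ring end.
      simpl. now rewrite sqrt_0.
    + unfold seminorm. rewrite (form_sub_l fH), !(form_sub_r fH).
      match goal with |- sqrt (Re ?z) < _ => replace z with (RtoC 0) by ring end.
      simpl. now rewrite sqrt_0.
  - intros s h' _. rewrite (form_sub_l fK). ring.
Qed.

Lemma proj_value_add k v k' v' :
  proj_value k v -> proj_value k' v' -> proj_value (plus k k') (plus v v').
Proof.
  intros [p [hp ho]] [p' [hp' ho']]. exists (plus p p'). split.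
  - intros e he.
    destruct (hp (e / 2) ltac:(lra)) as [s [h [hS [h1 h2]]]].
    destruct (hp' (e / 2) ltac:(lra)) as [s' [h' [hS' [h1' h2']]]].
    exists (plus s s'), (plus h h'). split; [auto|split].
    + apply Rle_lt_trans with (nK (p -- s) + nK (p' -- s')); [|lra].
      apply (seminorm_le_add_of_dual fK). intros w.
      rewrite !(form_sub_l fK), !(form_add_l _ _ _ fK). ring.
    + apply Rle_lt_trans with (nH (v -- h) + nH (v' -- h')); [|lra].
      apply (seminorm_le_add_of_dual fH). intros w.
      rewrite !(form_sub_l fH), !(form_add_l _ _ _ fH). ring.
  - intros s h hS.
    transitivity (inner K (k -- p) s + inner K (k' -- p') s)%C.
    + rewrite !(form_sub_l fK), !(form_add_l _ _ _ fK). ring.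
    + rewrite (ho s h hS), (ho' s h hS). ring.
Qed.

Lemma proj_value_scl a k v : proj_value k v -> proj_value (scal a k) (scal a v).
Proof.
  intros [p [hp ho]]. exists (scal a p). split.
  - intros e he. pose proof (Cmod_ge_0 a).
    assert (hq : 0 < e / (Cmod a + 1)) by (apply Rdiv_lt_0_compat; lra).
    destruct (hp _ hq) as [s [h [hS [h1 h2]]]].
    exists (scal a s), (scal a h). split; [auto|split].
    + replace (nK (scal a p -- scal a s)) with (nK (scal a (p -- s))).
      * rewrite (seminorm_scl fK). now apply Rmult_lt_of_div.
      * unfold seminorm.
        rewrite !(form_sub_l fK), !(form_sub_r fK), !(form_scl_l _ _ _ fK), !(form_scl_r fK),
          !(form_sub_l fK), !(form_sub_r fK).
        do 2 f_equal. ring.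
    + replace (nH (scal a v -- scal a h)) with (nH (scal a (v -- h))).
      * rewrite (seminorm_scl fH). now apply Rmult_lt_of_div.
      * unfold seminorm.
        rewrite !(form_sub_l fH), !(form_sub_r fH), !(form_scl_l _ _ _ fH), !(form_scl_r fH),
          !(form_sub_l fH), !(form_sub_r fH).
        do 2 f_equal. ring.
  - intros s h hS.
    transitivity (a * inner K (k -- p) s)%C.
    + rewrite !(form_sub_l fK), !(form_scl_l _ _ _ fK). ring.
    + rewrite (ho s h hS). ring.
Qed.

(** The residual [k - p] is orthogonal to the domain of [S], hence to its limit point [p]. This
    gives [|p| <= |k|], and [S_bound] passes to the limit at [p]. *)
Lemma proj_value_bound k v : proj_value k v -> nH v <= c * nK k.
Proof.
  intros [p [hp ho]].
  assert (hpp : inner K (k -- p) p = RtoC 0).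
  { apply Cmod_eq_of_small. intros e he.
    pose proof (seminorm_ge_0 (ip := inner K) (k -- p)) as h0.
    assert (hq : 0 < e / (nK (k -- p) + 1)) by (apply Rdiv_lt_0_compat; lra).
    destruct (hp _ hq) as [s [h [hS [h1 h2]]]].
    replace (inner K (k -- p) p - RtoC 0)%C with (inner K (k -- p) (p -- s)).
    2:{ rewrite (form_sub_r fK), (ho s h hS). ring. }
    apply Rle_lt_trans with (1 := form_cauchy_schwarz fK _ _).
    now apply Rmult_lt_of_div. }
  assert (hpk : nK p <= nK k).
  { apply Rsqr_incr_0_var; [|apply seminorm_ge_0]. unfold Rsqr.
    rewrite !(seminorm_sqr fK).
    pose proof (form_Re_sub fK k p) as h. pose proof (form_pos _ _ _ fK (k -- p)).
    pose proof (form_sub_l fK k p p) as h'. rewrite hpp in h'.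
    apply (f_equal Re) in h'.
    change (0 = Re (inner K k p) - Re (inner K p p)) in h'. lra. }
  apply Rle_trans with (c * nK p); [|now apply Rmult_le_compat_l].
  apply Rle_plus_epsilon. intros e he.
  assert (hq : 0 < e / (c + 1)) by (apply Rdiv_lt_0_compat; lra).
  destruct (hp _ hq) as [s [h [hS [h1 h2]]]].
  assert (E : e / (c + 1) * (c + 1) = e) by (field; lra).
  pose proof (seminorm_le_sub fH v h). pose proof (S_bound _ _ hS).
  pose proof (seminorm_le_sub fK s p) as h3. rewrite (seminorm_sub_sym fK) in h3.
  assert (c * nK s <= c * (e / (c + 1) + nK p)) by (apply Rmult_le_compat_l; lra).
  lra.
Qed.

(** Projection theorem for a subspace that need not be closed: a minimizing sequence for the
    distance from [k] to the domain is Cauchy, and by [S_bound] so are the values attached to it. *)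
Lemma proj_value_ex k : exists v, proj_value k v.
Proof.
  (* [completeness] yields suprema, so the squared distance appears as [- d]. *)
  destruct (completeness (fun r => exists s h, S s h /\ r = - Re (inner K (k -- s) (k -- s))))
    as [d [hub hl]].
  - exists 0. intros r [s [h [_ ->]]]. pose proof (form_pos _ _ _ fK (k -- s)). lra.
  - destruct S_ne as [s [h hS]]. eexists. exists s, h. split; [easy|reflexivity].
  - assert (hd : forall s h, S s h -> - d <= Re (inner K (k -- s) (k -- s))).
    { intros s h hS. assert (- Re (inner K (k -- s) (k -- s)) <= d); [|lra].
      apply hub. now exists s, h. }
    assert (hmin : forall n : nat, exists q : K * H, S (fst q) (snd q) /\
      Re (inner K (k -- fst q) (k -- fst q)) < - d + / (INR n + 1)).
    { intros n. apply NNPP. intros hn. pose proof (RinvN_pos n) as hpos.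
      assert (d <= d - / (INR n + 1)); [|lra]. apply hl. intros r [s [h [hS ->]]].
      apply Rnot_lt_le. intros hlt. apply hn. exists (s, h). simpl. split; [easy|lra]. }
    destruct (choice _ hmin) as [q hq]. clear hmin.
    set (s := fun n => fst (q n)). set (h := fun n => snd (q n)).
    assert (hS : forall n, S (s n) (h n)) by (intros n; apply hq).
    assert (hs : forall n, Re (inner K (k -- s n) (k -- s n)) < - d + / (INR n + 1))
      by (intros n; apply hq).
    (* Parallelogram law, with the midpoint of [s n] and [s m] as competitor for the distance. *)
    assert (par : forall n m, Re (inner K (s n -- s m) (s n -- s m))
      < 2 * / (INR n + 1) + 2 * / (INR m + 1)).
    { intros n m.
      pose proof (hd (scal (RtoC (/ 2)) (plus (s n) (s m))) _
        (S_scl (RtoC (/ 2)) _ _ (S_add _ _ _ _ (hS n) (hS m)))) as h1.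
      pose proof (hs n) as h2. pose proof (hs m) as h3.
      rewrite (form_Re_sub fK) in *.
      rewrite (form_Re_scl fK), (form_Re_add fK), (form_scl_r fK), (form_add_r fK) in h1.
      rewrite Cmod_R, Rabs_pos_eq in h1 by lra.
      match type of h1 with context [Re (Cconj (RtoC (/ 2)) * ?z)] =>
        replace (Re (Cconj (RtoC (/ 2)) * z)) with (/ 2 * Re z) in h1
          by (unfold Re; simpl; ring) end.
      change (Re (inner K k (s n) + inner K k (s m)))
        with (Re (inner K k (s n)) + Re (inner K k (s m))) in h1.
      unfold Rsqr in h1. lra. }
    assert (hcs : forall e, 0 < e -> exists N, forall n m, (N <= n)%nat -> (N <= m)%nat ->
      nK (s n -- s m) < e).
    { intros e he. destruct (inv_INR_small (e * e / 4)) as [N hN]; [nra|]. exists N. intros n m hn hm.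
      specialize (par n m). pose proof (hN n hn). pose proof (hN m hm).
      rewrite <- (seminorm_sqr fK) in par.
      apply Rsqr_incrst_0; [unfold Rsqr; lra|apply seminorm_ge_0|lra]. }
    destruct (Hilbert_complete K s hcs) as [p hp].
    destruct (Hilbert_complete H h) as [v hv].
    { intros e he. assert (hq' : 0 < e / (c + 1)) by (apply Rdiv_lt_0_compat; lra).
      destruct (hcs _ hq') as [N hN]. exists N. intros n m hn hm. specialize (hN n m hn hm).
      apply Rle_lt_trans with (1 := S_bound _ _ (S_sub _ _ _ _ (hS n) (hS m))).
      now apply Rmult_lt_of_div. }
    exists v, p. split.
    + intros e he.
      destruct (filter_ex _ (filter_and (F := eventually) _ _ (hp e he) (hv e he)))
        as [n [h1 h2]].
      exists (s n), (h n). rewrite (seminorm_sub_sym fK), (seminorm_sub_sym fH). auto.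
    + intros x y hxy. pose proof (form_pos _ _ _ fK x) as hx.
      (* The point [s n + t w x] also lies in the domain, so it improves on [s n] by less than
         [1/(n+1)]. Taking [t = 1/(1+|x|^2)] turns this into the bound on [|w|^2] and allows
         [x = 0]. *)
      assert (hw : forall n, (Cmod (inner K (k -- s n) x))²
        <= / (INR n + 1) * (1 + Re (inner K x x))).
      { intros n. set (w := inner K (k -- s n) x).
        set (t := / (1 + Re (inner K x x))).
        assert (ht : 0 < t) by (apply Rinv_0_lt_compat; lra).
        assert (ht1 : t * (1 + Re (inner K x x)) = 1) by (unfold t; field; lra).
        assert (E : inner K (k -- plus (s n) (scal (RtoC t * w)%C x))
                      (k -- plus (s n) (scal (RtoC t * w)%C x)) =
          inner K (k -- s n -- scal (RtoC t * w)%C x) (k -- s n -- scal (RtoC t * w)%C x)).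
        { rewrite !(form_sub_l fK), !(form_sub_r fK), !(form_add_l _ _ _ fK), !(form_add_r fK).
          ring. }
        assert (h1 : - d <= Re (inner K (k -- s n -- scal (RtoC t * w)%C x)
                                        (k -- s n -- scal (RtoC t * w)%C x))).
        { rewrite <- E.
          exact (hd _ _ (S_add _ _ _ _ (hS n) (S_scl (RtoC t * w)%C _ _ hxy))). }
        rewrite (form_Re_sub fK), (form_Re_scl fK), (form_scl_r fK), Cmod_mult, Cmod_R,
          Rsqr_mult, <- Rsqr_abs in h1. fold w in h1.
        replace (Re (Cconj (RtoC t * w) * w)) with (t * (Cmod w)²) in h1.
        2:{ unfold Rsqr, Cmod. rewrite sqrt_sqrt; [unfold Re; simpl; ring|nra]. }
        specialize (hs n). pose proof (Rle_0_sqr (Cmod w)) as hw0.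
        set (W := (Cmod w)²) in *.
        assert (h2 : 2 * (t * W) <= / (INR n + 1) + t * W * (t * Re (inner K x x)))
          by (unfold Rsqr in h1; lra).
        assert (h3 : t * Re (inner K x x) <= 1) by lra.
        assert (h4 : t * W <= / (INR n + 1)).
        { assert (t * W * (t * Re (inner K x x)) <= t * W * 1)
            by (apply Rmult_le_compat_l; nra). lra. }
        apply Rle_trans with (t * W * (1 + Re (inner K x x))).
        - right. transitivity (t * (1 + Re (inner K x x)) * W); [rewrite ht1|]; ring.
        - apply Rmult_le_compat_r; lra. }
      apply Cmod_eq_of_small. intros e he.
      replace (inner K (k -- p) x - RtoC 0)%C with (inner K (k -- p) x) by ring.
      assert (he1 : 0 < e / 2 / (nK x + 1))
        by (pose proof (seminorm_ge_0 (ip := inner K) x); apply Rdiv_lt_0_compat; lra).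
      assert (he2 : 0 < e * e / 4 / (1 + Re (inner K x x)))
        by (apply Rdiv_lt_0_compat; nra).
      destruct (inv_INR_small _ he2) as [N hN].
      destruct (hp _ he1) as [N' hN'].
      specialize (hN (max N N') ltac:(lia)). specialize (hN' (max N N') ltac:(lia)).
      specialize (hw (max N N')). set (n := max N N') in *.
      replace (inner K (k -- p) x) with (inner K (k -- s n) x + inner K (s n -- p) x)%C
        by (rewrite !(form_sub_l fK); ring).
      apply Rle_lt_trans with (1 := Cmod_triangle _ _).
      assert (h1 : Cmod (inner K (k -- s n) x) < e / 2).
      { apply Rsqr_incrst_0; [|apply Cmod_ge_0|lra].
        apply Rle_lt_trans with (1 := hw).
        apply Rlt_le_trans with (e * e / 4 / (1 + Re (inner K x x)) * (1 + Re (inner K x x))).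
        - apply Rmult_lt_compat_r; lra.
        - right. unfold Rsqr. field. lra. }
      assert (h2 : Cmod (inner K (s n -- p) x) <= e / 2).
      { apply Rle_trans with (1 := form_cauchy_schwarz fK _ _).
        rewrite Rmult_comm. left.
        apply Rmult_lt_of_div; [apply seminorm_ge_0|lra|easy]. }
      lra.
Qed.

(** [S] is a relation because a vector of [K] may come from many formal sums. Uniqueness of the
    projected value is the bound applied to a difference, lying over [k - k] of norm [0]; it also
    makes the chosen [A] linear. *)
Lemma graph_extension : exists A : K -> H, bounded_linear A /\
  (forall k, norm (A k) <= c * norm k) /\ (forall k h, S k h -> A k = h).
Proof.
  destruct (choice _ proj_value_ex) as [A hA].
  assert (uniq : forall k v v', proj_value k v -> proj_value k v' -> v = v').
  { intros k v v' h h'.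
    assert (h2 : proj_value (k -- k) (v -- v'))
      by (apply proj_value_add; [easy|now apply proj_value_scl]).
    apply proj_value_bound in h2.
    replace (nK (k -- k)) with 0 in h2.
    2:{ unfold seminorm. rewrite (form_sub_l fK), !(form_sub_r fK).
        match goal with |- _ = sqrt (Re ?z) => replace z with (RtoC 0) by ring end.
        simpl. now rewrite sqrt_0. }
    rewrite Rmult_0_r, <- Hilbert_sub, <- Hilbert_norm in h2.
    pose proof (norm_ge_0 (minus v v' : H)) as h3.
    apply (fun E => plus_reg_r (opp v') v v' (eq_trans (norm_eq_zero _ E) (eq_sym (plus_opp_r v')))).
    apply Rle_antisym; [exact h2|exact h3]. }
  assert (bd : forall k, norm (A k) <= c * norm k).
  { intros k. rewrite !Hilbert_norm. now apply proj_value_bound. }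
  exists A. split; [split; [|split]|split].
  - intros x y. apply (uniq (plus x y)); [apply hA|]. now apply proj_value_add.
  - intros a x. apply (uniq (scal a x)); [apply hA|]. now apply proj_value_scl.
  - exists c. exact bd.
  - exact bd.
  - intros k h hS. apply (uniq k); [apply hA|now apply proj_value_S].
Qed.

End Extension.

(** * Bounds for semigroups and the similarity constant *)

Section Semigroup.

Context {H : NormedModule C_AbsRing} {T : R -> H -> H}.
Hypothesis HT : C0_semigroup T.

Lemma C0_near (x : H) (e : R) :
  0 < e -> exists d, 0 < d /\ forall t, 0 <= t < d -> norm (minus (T t x) x) < e.
Proof.
  intros he. destruct HT as [_ [h0 [_ hc]]].
  destruct (proj1 (filterlim_locally_ball_norm (fun t => T t x) x) (hc x) (mkposreal e he))
    as [d hd].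
  exists d. split; [apply cond_pos|]. intros t [ht htd].
  destruct (Rle_lt_or_eq_dec _ _ ht) as [h|<-].
  - apply (hd t); [|easy]. change (Rabs (t - 0) < d). rewrite Rabs_pos_eq; lra.
  - rewrite h0, norm_minus_self. easy.
Qed.

Hypothesis HC : seq_complete H.

(** Otherwise there are times [t n] tending to [0] with [T (t n)] of norm above [n]. Strong
    continuity makes each sequence [T (t n) x] bounded, and uniform boundedness contradicts the
    growth. *)
Lemma semigroup_bound_near : exists d L, 0 < d /\ 0 <= L /\
  forall t x, 0 <= t <= d -> norm (T t x) <= L * norm x.
Proof.
  destruct HT as [hb [h0 _]]. apply NNPP. intros hn.
  assert (hk : forall n : nat, exists t, 0 <= t <= / (INR n + 1) /\
    exists x, INR n * norm x < norm (T t x)).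
  { intros n. apply NNPP. intros hn'. apply hn. exists (/ (INR n + 1)), (INR n).
    split; [apply RinvN_pos|split; [apply pos_INR|]]. intros t x ht.
    apply Rnot_lt_le. intros hlt. apply hn'. exists t. split; [easy|]. now exists x. }
  destruct (choice _ hk) as [t ht]. clear hk.
  destruct (uniform_boundedness (fun n => T (t n)) HC) as [L hL].
  - intros n. apply hb. apply ht.
  - intros x. destruct (filterlim_bounded (fun n => T (t n) x)) as [M hM]; [|now exists M].
    exists x. apply (filterlim_locally_ball_norm (fun n => T (t n) x) x). intros e.
    destruct (C0_near x e (cond_pos e)) as [d [hd hd']].
    destruct (RinvN_cv hd) as [N hN]. exists N. intros n hn'. apply hd'.
    specialize (hN n hn'). unfold Rdist in hN. simpl in hN. rewrite Rminus_0_r in hN.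
    apply Rabs_lt_between in hN. destruct (ht n) as [h _]. lra.
  - destruct (INR_archimed 1 L Rlt_0_1) as [n hn']. rewrite Rmult_1_r in hn'.
    destruct (ht n) as [_ [x hx]]. pose proof (hL n x). pose proof (norm_ge_0 x). nra.
Qed.

Lemma semigroup_bound (tau : R) : exists L, 0 <= L /\
  forall t x, 0 <= t <= tau -> norm (T t x) <= L * norm x.
Proof.
  destruct semigroup_bound_near as [d [L [hd [hL hb]]]]. destruct HT as [_ [_ [hs _]]].
  assert (key : forall n, exists L', 0 <= L' /\
    forall t x, 0 <= t <= INR n * d -> norm (T t x) <= L' * norm x).
  { induction n as [|n [L' [hL' IH]]].
    - exists L. split; [easy|]. intros t x ht. simpl in ht. apply hb. lra.
    (* [L'] serves times up to [n * d], and [L * L'] later ones. If [n = 0] and [t < d], subtracting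
       [d] is impossible; then [norm x <= L' * norm x], the bound at time [0], helps. *)
    - exists (L' + L * L'). split; [nra|]. intros t x ht. rewrite S_INR in ht.
      pose proof (norm_ge_0 x) as hx. pose proof (Rmult_le_pos _ _ hL hL').
      destruct (Rle_dec t (INR n * d)) as [h|h].
      + pose proof (IH t x ltac:(lra)). nra.
      + replace t with (d + (t - d)) by ring.
        destruct (Rle_dec d t) as [h'|h'].
        * rewrite hs by lra. apply Rle_trans with (1 := hb d (T (t - d) x) ltac:(lra)).
          pose proof (IH (t - d) x ltac:(lra)). nra.
        * assert (n = 0%nat) as ->.
          { destruct n; [easy|]. exfalso. rewrite S_INR in h.
            pose proof (Rmult_le_pos _ _ (pos_INR n) (Rlt_le _ _ hd)). lra. }
          simpl in *. replace (d + (t - d)) with t by ring.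
          assert (norm x <= L' * norm x).
          { destruct HT as [_ [h0 _]]. rewrite <- (h0 x) at 1. apply IH. lra. }
          pose proof (hb t x ltac:(lra)). nra. }
  destruct (INR_archimed d tau hd) as [n hn].
  destruct (key n) as [L' [hL' h]]. exists L'. split; [easy|]. intros t x ht. apply h. lra.
Qed.

(** The supremum ranges over times with a finite operator norm; [opnorm_finite] shows that these are
    all the times, and [semigroup_bound] keeps the supremum finite. *)
Lemma sup_norm_finite (tau : R) : 0 <= tau ->
  exists M, sup_norm_on T tau = Finite M /\ 0 <= M /\
    forall t x, 0 <= t <= tau -> norm (T t x) <= M * norm x.
Proof.
  intros htau. destruct (semigroup_bound tau) as [L [hL hb]].
  destruct (Lub_Rbar_correct (fun r => exists t, 0 <= t <= tau /\ opnorm (T t) = Finite r))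
    as [hub hl].
  fold (sup_norm_on T tau) in hub, hl.
  assert (hup : Rbar_le (sup_norm_on T tau) L).
  { apply hl. intros r [t [ht E]]. rewrite <- E. apply opnorm_le; auto. }
  destruct (opnorm_finite (T 0)) as [L0 [E0 [hL0 _]]]; [apply HT; lra|].
  assert (h0 : Rbar_le L0 (sup_norm_on T tau)) by (apply hub; exists 0; split; [lra|easy]).
  destruct (sup_norm_on T tau) as [M| |]; try easy.
  exists M. split; [easy|split]; [simpl in h0; lra|]. intros t x ht.
  destruct (opnorm_finite (T t)) as [Lt [Et [_ [hx _]]]]; [apply HT; lra|].
  apply Rle_trans with (1 := hx x). apply Rmult_le_compat_r; [apply norm_ge_0|].
  apply (hub Lt). now exists t.
Qed.

End Semigroup.

Lemma bounded_linear_comp {U V W : NormedModule C_AbsRing} (g : V -> W) (f : U -> V) :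
  bounded_linear g -> bounded_linear f -> bounded_linear (fun x => g (f x)).
Proof.
  intros hg hf.
  destruct (opnorm_finite g hg) as [L [_ [hL [hLg _]]]].
  destruct hg as [hg1 [hg2 _]], hf as [hf1 [hf2 [M hM]]].
  split; [|split].
  - intros x y. now rewrite hf1, hg1.
  - intros a x. now rewrite hf2, hg2.
  - exists (L * M). intros x. apply Rle_trans with (1 := hLg _).
    rewrite Rmult_assoc. now apply Rmult_le_compat_l.
Qed.

(** [S] is a nearly optimal similarity, [a] and [b] are the norms of [S] and of its inverse.
    Inequalities in terms of [S] replace the inverse, since the form built from [S] does not mention
    it. *)
Lemma sim_const_finite {H : NormedModule C_AbsRing} (T : H -> H) :
  bounded_linear T -> similar_to_contraction T ->
  exists c, sim_const T = Finite c /\ 0 <= c /\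
    forall e, 0 < e -> exists (S : H -> H) (a b : R),
      bounded_linear S /\ 0 <= a /\ 0 <= b /\
      (forall x, norm (S x) <= a * norm x) /\ (forall x, norm x <= b * norm (S x)) /\
      (forall x, norm (S (T x)) <= norm (S x)) /\ a * b <= c + e.
Proof.
  intros hT hsim. unfold sim_const. match goal with |- context [Glb_Rbar ?P] => set (E := P) end.
  destruct (Glb_Rbar_correct E) as [hlb hg].
  assert (hfin : exists r, E r).
  { destruct hsim as [S [Si [hS [hSi [h1 [h2 h3]]]]]].
    destruct (opnorm_finite S hS) as [a [Ea _]]. destruct (opnorm_finite Si hSi) as [b [Eb _]].
    exists (a * b). unfold E. exists S, Si. rewrite Ea, Eb.
    exact (conj hS (conj hSi (conj h1 (conj h2 (conj h3 eq_refl))))). }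
  assert (hpos : Rbar_le 0 (Glb_Rbar E)).
  { apply hg. intros r [S [Si [hS [hSi [_ [_ [_ Er]]]]]]].
    destruct (opnorm_finite S hS) as [a [Ea [ha _]]].
    destruct (opnorm_finite Si hSi) as [b [Eb [hb _]]].
    rewrite Ea, Eb in Er. injection Er as <-. simpl. now apply Rmult_le_pos. }
  destruct hfin as [r0 hr0]. pose proof (hlb r0 hr0) as hr0'.
  destruct (Glb_Rbar E) as [c| |]; try easy.
  exists c. split; [easy|split; [easy|]]. intros e he.
  assert (hr : exists r, E r /\ r < c + e).
  { apply NNPP. intros hn. assert (hle : Rbar_le (c + e) c); [|simpl in hle; lra].
    apply hg. intros r hr. apply Rnot_lt_le. intros hlt. apply hn. now exists r. }
  destruct hr as [r [[S [Si [hS [hSi [h1 [h2 [h3 Er]]]]]]] hr]].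
  destruct (opnorm_finite S hS) as [a [Ea [ha [hax _]]]].
  destruct (opnorm_finite Si hSi) as [b [Eb [hb [hbx _]]]].
  rewrite Ea, Eb in Er. injection Er as Er.
  exists S, a, b. split; [easy|]. split; [easy|]. split; [easy|]. split; [easy|]. split.
  - intros x. rewrite <- (h2 x) at 1. apply hbx.
  - split; [|lra]. intros x.
    destruct (opnorm_finite (fun x => S (T (Si x)))) as [d [Ed [_ [hd _]]]].
    { apply (bounded_linear_comp S (fun x => T (Si x))); [easy|].
      now apply (bounded_linear_comp T Si). }
    rewrite Ed in h3. simpl in h3. specialize (hd (S x)). rewrite h2 in hd.
    apply Rle_trans with (1 := hd). pose proof (norm_ge_0 (S x)). nra.
Qed.

(** * A form for which the whole semigroup is contractive *)

Section FormOps.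

Context {G : Type} {add : G -> G -> G} {scl : C -> G -> G}.

Lemma psd_pull {V : Type} {addV : V -> V -> V} {sclV : C -> V -> V} (p : V -> V -> C) (L : G -> V) :
  psd_form addV sclV p -> (forall x y, L (add x y) = addV (L x) (L y)) ->
  (forall a x, L (scl a x) = sclV a (L x)) -> psd_form add scl (fun x y => p (L x) (L y)).
Proof.
  intros Hp hadd hscl. split.
  - intros x y z. rewrite hadd. apply (form_add_l _ _ _ Hp).
  - intros a x y. rewrite hscl. apply (form_scl_l _ _ _ Hp).
  - intros x y. apply (form_conj _ _ _ Hp).
  - intros x. apply (form_pos _ _ _ Hp).
Qed.

Lemma psd_scale (r : R) (p : G -> G -> C) :
  0 <= r -> psd_form add scl p -> psd_form add scl (fun x y => (RtoC r * p x y)%C).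
Proof.
  intros hr Hp. split.
  - intros x y z. rewrite (form_add_l _ _ _ Hp). ring.
  - intros a x y. rewrite (form_scl_l _ _ _ Hp). ring.
  - intros x y. rewrite (form_conj _ _ _ Hp). Cpair_ring.
  - intros x. pose proof (form_pos _ _ _ Hp x).
    replace (Re (RtoC r * p x x)) with (r * Re (p x x)) by (unfold Re; simpl; ring). nra.
Qed.

Fixpoint form_sum (q : nat -> G -> G -> C) (m : nat) (x y : G) : C :=
  match m with O => RtoC 0 | S m => (form_sum q m x y + q m x y)%C end.

Fixpoint real_sum (f : nat -> R) (m : nat) : R :=
  match m with O => 0 | S m => real_sum f m + f m end.

Lemma psd_form_sum (q : nat -> G -> G -> C) (m : nat) :
  (forall k, psd_form add scl (q k)) -> psd_form add scl (form_sum q m).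
Proof.
  intros Hq. induction m as [|m IH]; simpl.
  - split; intros; try (simpl; lra); Cpair_ring.
  - split; intros.
    + rewrite (form_add_l _ _ _ IH), (form_add_l _ _ _ (Hq m)). ring.
    + rewrite (form_scl_l _ _ _ IH), (form_scl_l _ _ _ (Hq m)). ring.
    + rewrite (form_conj _ _ _ IH), (form_conj _ _ _ (Hq m)). Cpair_ring.
    + apply Rplus_le_le_0_compat; [apply (form_pos _ _ _ IH)|apply (form_pos _ _ _ (Hq m))].
Qed.

Lemma form_sum_Re (q : nat -> G -> G -> C) (m : nat) (x : G) :
  Re (form_sum q m x x) = real_sum (fun k => Re (q k x x)) m.
Proof. induction m as [|m IH]; simpl; [easy|]. now rewrite <- IH. Qed.

Lemma real_sum_ext (f g : nat -> R) (m : nat) :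
  (forall k, f k = g k) -> real_sum f m = real_sum g m.
Proof. intros h. induction m as [|m IH]; simpl; [easy|]. now rewrite IH, h. Qed.

Lemma real_sum_shift (f : nat -> R) (m : nat) :
  real_sum (fun k => f (S k)) m = real_sum f m + f m - f O.
Proof. induction m as [|m IH]; simpl; [ring|]. rewrite IH. ring. Qed.

Lemma real_sum_le_const (f : nat -> R) (m : nat) (a : R) :
  (forall k, (k < m)%nat -> f k <= a) -> real_sum f m <= INR m * a.
Proof.
  intros h. induction m as [|m IH].
  - simpl. lra.
  - rewrite S_INR. simpl. pose proof (h m ltac:(lia)).
    pose proof (IH ltac:(intros; apply h; lia)). lra.
Qed.

(** At least [min(m,s)] of the indices below [m] satisfy [k <= s], because [k = 0] counts too; each
    of them contributes at least [g]. *)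
Lemma real_sum_ge_prefix (f : nat -> R) (m : nat) (g s : R) :
  (forall k, 0 <= f k) -> 0 <= g ->
  (forall k, INR k <= s -> (k < m)%nat -> g <= f k) -> g * Rmin (INR m) s <= real_sum f m.
Proof.
  intros hf hg h. induction m as [|m IH].
  - simpl. pose proof (Rmin_l 0 s). nra.
  - simpl real_sum. specialize (IH ltac:(intros; apply h; [easy|lia])). rewrite S_INR.
    destruct (Rle_dec (INR m) s) as [hm|hm].
    + pose proof (h m hm ltac:(lia)).
      assert (Rmin (INR m + 1) s <= Rmin (INR m) s + 1).
      { rewrite (Rmin_left (INR m)) by easy. apply Rmin_l. }
      nra.
    + rewrite Rmin_right in IH |- * by lra. pose proof (hf m). lra.
Qed.

Lemma psd_limit {F : (nat -> Prop) -> Prop} {FF : ProperFilter F}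
  (q : nat -> G -> G -> C) (b : G -> G -> C) :
  (forall n, psd_form add scl (q n)) -> (forall x y, tends F (fun n => q n x y) (b x y)) ->
  psd_form add scl b.
Proof.
  intros Hq hb. split.
  - intros x y z. apply (tends_unique (F := F)) with (1 := hb _ _).
    apply tends_ext with (2 := tends_plus _ _ _ _ (hb x z) (hb y z)).
    intros n. symmetry. apply (form_add_l _ _ _ (Hq n)).
  - intros a x y. apply (tends_unique (F := F)) with (1 := hb _ _).
    apply tends_ext with (2 := tends_scal a _ _ (hb x y)).
    intros n. symmetry. apply (form_scl_l _ _ _ (Hq n)).
  - intros x y. apply (tends_unique (F := F)) with (1 := hb _ _).
    apply tends_ext with (2 := tends_conj _ _ (hb x y)).
    intros n. symmetry. apply (form_conj _ _ _ (Hq n)).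
  - intros x. apply (tends_Re_ge (F := F)) with (2 := hb x x).
    intros e he. apply filter_forall. intros n. pose proof (form_pos _ _ _ (Hq n) x). lra.
Qed.

End FormOps.

(** * Averaging a form along the semigroup *)

Section Averaging.

Context {G : Type} {add : G -> G -> G} {scl : C -> G -> G} {i : G -> G -> C}.
Hypothesis Hi : psd_form add scl i.
Variable T : R -> G -> G.
Hypothesis T_add : forall t x y, 0 <= t -> T t (add x y) = add (T t x) (T t y).
Hypothesis T_scl : forall t a x, 0 <= t -> T t (scl a x) = scl a (T t x).
Hypothesis T_0 : forall x, T 0 x = x.
Hypothesis T_plus : forall s t x, 0 <= s -> 0 <= t -> T (s + t) x = T s (T t x).

Local Notation sq p x := (Re (p x x)).

Variables (tau1 tau2 M : R).
Hypothesis htau : 0 < tau2 <= tau1.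
Hypothesis hM : 0 <= M.
Hypothesis T_bound : forall t x, 0 <= t <= tau1 -> sq i (T t x) <= M² * sq i x.

(** Left Riemann sum for the mean of [p(T(s)x, T(s)y)] over [[0,tau1]]. *)
Definition average (p : G -> G -> C) (N : nat) (x y : G) : C :=
  (RtoC (/ INR N) *
   form_sum (fun k x y => p (T (INR k * (tau1 / INR N)) x) (T (INR k * (tau1 / INR N)) y)) N x y)%C.

Section Average.

Variables (p : G -> G -> C) (N : nat).
Hypothesis Hp : psd_form add scl p.
Hypothesis hN : (0 < N)%nat.

Let hN' : 0 < INR N.
Proof. now apply lt_0_INR. Qed.

Let hh : 0 < tau1 / INR N.
Proof. apply Rdiv_lt_0_compat; lra. Qed.

Let hk (k : nat) : 0 <= INR k * (tau1 / INR N).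
Proof. apply Rmult_le_pos; [apply pos_INR|lra]. Qed.

Lemma average_psd : psd_form add scl (average p N).
Proof.
  apply psd_scale; [left; now apply Rinv_0_lt_compat|].
  apply psd_form_sum. intros k. refine (psd_pull p (T (INR k * (tau1 / INR N))) Hp _ _); auto.
Qed.

Lemma average_Re (x : G) : sq (average p N) x =
  / INR N * real_sum (fun k => sq p (T (INR k * (tau1 / INR N)) x)) N.
Proof.
  unfold average. set (q := fun (k : nat) (x y : G) => _).
  transitivity (/ INR N * Re (form_sum q N x x)); [unfold Re; simpl; ring|].
  now rewrite form_sum_Re.
Qed.

Hypothesis hp1 : forall x, sq p (T tau1 x) <= sq p x.

(** A shift by the mesh width moves nodes to nodes, so the two sums differ only by the end terms
    [p(T(tau1)x) - p(x)], which [hp1] makes nonpositive. *)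
Lemma average_step (x : G) : sq (average p N) (T (tau1 / INR N) x) <= sq (average p N) x.
Proof.
  rewrite !average_Re. apply Rmult_le_compat_l; [left; now apply Rinv_0_lt_compat|].
  set (f := fun k => sq p (T (INR k * (tau1 / INR N)) x)).
  apply Rle_trans with (real_sum (fun k => f (S k)) N).
  - right. apply real_sum_ext. intros k. unfold f.
    rewrite <- T_plus by (auto; lra).
    replace (INR (S k) * (tau1 / INR N)) with (INR k * (tau1 / INR N) + tau1 / INR N)
      by (rewrite S_INR; ring).
    reflexivity.
  - rewrite real_sum_shift. unfold f.
    replace (INR N * (tau1 / INR N)) with tau1 by (field; lra).
    simpl (INR 0). rewrite Rmult_0_l, T_0. pose proof (hp1 x). lra.
Qed.

Lemma average_steps (j : nat) (x : G) :
  sq (average p N) (T (INR j * (tau1 / INR N)) x) <= sq (average p N) x.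
Proof.
  induction j as [|j IH].
  - simpl (INR 0). rewrite Rmult_0_l, T_0. lra.
  - apply Rle_trans with (2 := IH).
    replace (INR (S j) * (tau1 / INR N)) with (tau1 / INR N + INR j * (tau1 / INR N))
      by (rewrite S_INR; ring).
    rewrite T_plus by (auto; lra). apply average_step.
Qed.

Lemma average_le (a : R) (x : G) : 0 <= a -> (forall y, sq p y <= a * sq i y) ->
  sq (average p N) x <= a * M² * sq i x.
Proof.
  intros ha h. rewrite average_Re.
  apply Rle_trans with (/ INR N * (INR N * (a * M² * sq i x))); [|right; field; lra].
  apply Rmult_le_compat_l; [left; now apply Rinv_0_lt_compat|].
  apply real_sum_le_const. intros k hkN. apply Rle_trans with (1 := h _).
  rewrite Rmult_assoc. apply Rmult_le_compat_l; [easy|]. apply T_bound. split; [auto|].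
  apply Rle_trans with (INR N * (tau1 / INR N)); [|right; field; lra].
  apply Rmult_le_compat_r; [lra|]. apply le_INR. lia.
Qed.

(** A node [s <= tau2] satisfies [|T(tau2)x|^2 <= M^2 |T(s)x|^2], which is at most [M^2] times the
    value of [p] there, and such nodes make up at least the fraction [tau2/tau1]. The case [M = 0]
    is separate because of a division by [M^2]. *)
Lemma average_ge (x : G) : (forall y, sq i y <= sq p y) ->
  tau2 / tau1 * sq i (T tau2 x) <= M² * sq (average p N) x.
Proof.
  intros h. rewrite average_Re.
  set (f := fun k => sq p (T (INR k * (tau1 / INR N)) x)).
  destruct (Rle_lt_or_eq_dec _ _ (Rle_0_sqr M)) as [hM2|hM2].
  - pose proof (real_sum_ge_prefix f N (sq i (T tau2 x) / M²) (tau2 / (tau1 / INR N))) as hs.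
    rewrite Rmin_right in hs.
    2:{ apply Rmult_le_reg_r with (tau1 / INR N); [easy|].
        replace (tau2 / (tau1 / INR N) * (tau1 / INR N)) with tau2 by (field; lra).
        replace (INR N * (tau1 / INR N)) with tau1 by (field; lra). lra. }
    assert (hs' : sq i (T tau2 x) / M² * (tau2 / (tau1 / INR N)) <= real_sum f N).
    { apply hs.
      - intros k. apply (form_pos _ _ _ Hp).
      - apply Rdiv_le_0_compat; [apply (form_pos _ _ _ Hi)|easy].
      - intros k hks _. unfold f.
        assert (hk2 : INR k * (tau1 / INR N) <= tau2).
        { replace tau2 with (tau2 / (tau1 / INR N) * (tau1 / INR N)) by (field; lra).
          apply Rmult_le_compat_r; lra. }
        apply Rmult_le_reg_r with M²; [easy|].
        replace (sq i (T tau2 x) / M² * M²) with (sq i (T tau2 x)) by (field; lra).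
        replace tau2 with ((tau2 - INR k * (tau1 / INR N)) + INR k * (tau1 / INR N)) by ring.
        pose proof (hk k).
        rewrite T_plus by lra. apply Rle_trans with
          (1 := T_bound (tau2 - INR k * (tau1 / INR N)) (T (INR k * (tau1 / INR N)) x) ltac:(lra)).
        rewrite Rmult_comm. apply Rmult_le_compat_r; [lra|]. apply h. }
    apply Rle_trans with (M² * (/ INR N * (sq i (T tau2 x) / M² * (tau2 / (tau1 / INR N))))).
    + right. field. repeat split; lra.
    + apply Rmult_le_compat_l; [lra|].
      apply Rmult_le_compat_l; [left; now apply Rinv_0_lt_compat|easy].
  - pose proof (T_bound tau2 x ltac:(lra)) as h0. rewrite <- hM2 in h0 |- *.
    pose proof (form_pos _ _ _ Hi (T tau2 x)).
    assert (sq i (T tau2 x) = 0) as -> by lra. lra.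
Qed.

End Average.

Variable c : R.
Hypothesis hc : 0 <= c.
Hypothesis T_near : forall x e, 0 < e -> exists d, 0 < d /\ forall t, 0 <= t < d ->
  seminorm i (fsub add scl (T t x) x) < e.
Hypothesis sim : forall e, 0 < e -> exists p, psd_form add scl p /\
  (forall x, sq p (T tau1 x) <= sq p x) /\ (forall x, sq i x <= sq p x) /\
  (forall x, sq p x <= (c + e)² * sq i x).

(* Averaging over a grid only makes the grid times contractive; along an ultrafilter the
   mesh tends to [0] and the infimum [c] of the similarity constants is reached. *)
Lemma invariant_form : exists b, psd_form add scl b /\
  (forall t x, 0 <= t -> sq b (T t x) <= sq b x) /\
  (forall x, sq b x <= (c * M)² * sq i x) /\
  (forall x, tau2 / tau1 * sq i (T tau2 x) <= M² * sq b x).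
Proof.
  destruct (choice (fun (n : nat) p => psd_form add scl p /\
    (forall x, sq p (T tau1 x) <= sq p x) /\ (forall x, sq i x <= sq p x) /\
    (forall x, sq p x <= (c + / (INR n + 1))² * sq i x))) as [p hp].
  { intros n. apply sim, RinvN_pos. }
  set (B := fun n => average (p n) (S n)).
  assert (HB : forall n, psd_form add scl (B n)).
  { intros n. apply average_psd; [apply hp|lia]. }
  assert (hB : forall n x, sq (B n) x <= (c + / (INR n + 1))² * M² * sq i x).
  { intros n x. apply average_le; [lia|apply Rle_0_sqr|apply hp]. }
  assert (hn1 : forall n, 0 < / (INR n + 1) <= 1).
  { intros n. split; [apply RinvN_pos|]. rewrite <- Rinv_1.
    apply Rinv_le_contravar; [lra|]. pose proof (pos_INR n). lra. }
  (* As [1/(n+1) <= 1], this constant bounds all the [B n] at once, so that limits along the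
     ultrafilter exist. *)
  set (D := (c + 1) * M).
  assert (hD : 0 <= D) by (apply Rmult_le_pos; lra).
  assert (hBD : forall n x, seminorm (B n) x <= D * seminorm i x).
  { intros n x. apply Rsqr_incr_0_var.
    - rewrite Rsqr_mult. unfold Rsqr at 1 3.
      rewrite (seminorm_sqr (HB n)), (seminorm_sqr Hi).
      apply Rle_trans with (1 := hB n x). apply Rmult_le_compat_r; [apply (form_pos _ _ _ Hi)|].
      unfold D. rewrite Rsqr_mult. apply Rmult_le_compat_r; [apply Rle_0_sqr|].
      specialize (hn1 n). apply Rsqr_incr_1; lra.
    - apply Rmult_le_pos; [easy|apply seminorm_ge_0]. }
  destruct exists_ultrafilter as [U [UP [UE UU]]].
  assert (hlim : forall q : G * G, exists l, tends U (fun n => B n (fst q) (snd q)) l).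
  { intros [x y]. apply (ultra_tends UU) with (D * seminorm i x * (D * seminorm i y)).
    intros n. simpl. apply Rle_trans with (1 := form_cauchy_schwarz (HB n) x y).
    apply Rmult_le_compat; auto using seminorm_ge_0. }
  destruct (choice _ hlim) as [b' hb']. set (b := fun x y => b' (x, y)).
  assert (hb : forall x y, tends U (fun n => B n x y) (b x y)) by (intros x y; apply (hb' (x, y))).
  exists b. split; [exact (psd_limit B b HB hb)|]. split; [|split].
  - intros t x ht.
    assert (key : Re (b (T t x) (T t x) + RtoC (-1) * b x x) <= 0).
    2:{ replace (Re (b (T t x) (T t x) + RtoC (-1) * b x x))
          with (sq b (T t x) - sq b x) in key by (unfold Re; simpl; ring). lra. }
    apply (tends_Re_le (F := U))
      with (u := fun n => (B n (T t x) (T t x) + RtoC (-1) * B n x x)%C).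
    2:{ apply tends_plus; [apply hb|]. apply tends_scal, hb. }
    intros e he. pose proof (seminorm_ge_0 (ip := i) x) as hx0.
    (* For [dl <= 1] and [v <= D |x|], the increment [(D dl + v)^2 - v^2] is at most [m * dl]. *)
    set (m := D * D * (2 * seminorm i x + 1)).
    assert (hm : 0 <= m) by (unfold m; apply Rmult_le_pos; nra).
    set (dl := Rmin 1 (e / (m + 1))).
    assert (hdl : 0 < dl) by (apply Rmin_glb_lt; [lra|apply Rdiv_lt_0_compat; lra]).
    assert (hdl1 : dl <= 1) by apply Rmin_l.
    assert (hdle : m * dl <= e).
    { apply Rle_trans with (m * (e / (m + 1))); [apply Rmult_le_compat_l; [easy|apply Rmin_r]|].
      left. assert (0 < e / (m + 1)) by (apply Rdiv_lt_0_compat; lra).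
      assert (e / (m + 1) * (m + 1) = e) by (field; lra). lra. }
    destruct (T_near x dl hdl) as [d [hd hd']].
    apply UE.
    destruct (RinvN_cv (eps := d / tau1) ltac:(apply Rdiv_lt_0_compat; lra)) as [N0 hN0].
    exists N0. intros n hn.
    assert (hh : 0 < tau1 / INR (S n)) by (apply Rdiv_lt_0_compat; [lra|apply lt_0_INR; lia]).
    assert (hhd : tau1 / INR (S n) < d).
    { specialize (hN0 n hn). unfold Rdist in hN0. simpl in hN0. rewrite Rminus_0_r in hN0.
      apply Rabs_lt_between in hN0. rewrite S_INR.
      replace d with (tau1 * (d / tau1)) by (field; lra).
      apply Rmult_lt_compat_l; lra. }
    (* Write [t = j h + r] with mesh [h] and [0 <= r < h]: [average_steps] handles [j h], and strong
       continuity makes [T r x] close to [x]. *)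
    destruct (nfloor_ex (t / (tau1 / INR (S n)))) as [j [hj1 hj2]].
    { apply Rdiv_le_0_compat; lra. }
    set (r := t - INR j * (tau1 / INR (S n))).
    assert (hr : 0 <= r < tau1 / INR (S n)).
    { set (h := tau1 / INR (S n)) in *.
      assert (Et : t / h * h = t) by (field; lra). unfold r. split.
      - pose proof (Rmult_le_compat_r h _ _ (Rlt_le _ _ hh) hj1). lra.
      - pose proof (Rmult_lt_compat_r h _ _ hh hj2). lra. }
    assert (E : T t x = T (INR j * (tau1 / INR (S n))) (T r x)).
    { rewrite <- T_plus.
      - f_equal. unfold r. ring.
      - apply Rmult_le_pos; [apply pos_INR|lra].
      - lra. }
    pose proof (average_steps (p n) (S n) ltac:(lia) (proj1 (proj2 (hp n))) j (T r x)) as h1.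
    rewrite <- E in h1. fold (B n) in h1.
    replace (Re (B n (T t x) (T t x) + RtoC (-1) * B n x x))
      with (sq (B n) (T t x) - sq (B n) x) by (unfold Re; simpl; ring).
    pose proof (seminorm_le_sub (HB n) (T r x) x) as h2.
    pose proof (hBD n (fsub add scl (T r x) x)) as h3.
    pose proof (hd' r ltac:(lra)) as h4. pose proof (hBD n x) as h5.
    pose proof (seminorm_ge_0 (ip := B n) (T r x)) as h6.
    pose proof (seminorm_ge_0 (ip := B n) x) as h7.
    rewrite <- (seminorm_sqr (HB n) (T r x)) in h1. rewrite <- (seminorm_sqr (HB n) x).
    set (u := seminorm (B n) (T r x)) in *. set (v := seminorm (B n) x) in *.
    assert (h8 : u <= D * dl + v).
    { assert (D * seminorm i (fsub add scl (T r x) x) <= D * dl)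
        by (apply Rmult_le_compat_l; lra). lra. }
    assert (h9 : u * u <= (D * dl + v) * (D * dl + v)) by (apply Rmult_le_compat; lra).
    assert (h10 : D * dl * v <= D * dl * (D * seminorm i x))
      by (apply Rmult_le_compat_l; [apply Rmult_le_pos; lra|easy]).
    assert (h11 : D * D * dl * dl <= D * D * dl * 1)
      by (apply Rmult_le_compat_l; [apply Rmult_le_pos; nra|easy]).
    unfold m in hdle. lra.
  - intros x. apply (tends_Re_le (F := U)) with (2 := hb x x). intros e he.
    pose proof (form_pos _ _ _ Hi x) as hx.
    set (m := (2 * c + 1) * (M² * sq i x)).
    assert (hm : 0 <= m) by (unfold m; pose proof (Rle_0_sqr M); apply Rmult_le_pos; nra).
    apply UE.
    destruct (RinvN_cv (eps := e / (m + 1)) ltac:(apply Rdiv_lt_0_compat; lra)) as [N0 hN0].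
    exists N0. intros n hn. specialize (hN0 n hn).
    unfold Rdist in hN0. simpl in hN0. rewrite Rminus_0_r in hN0. apply Rabs_lt_between in hN0.
    apply Rle_trans with (1 := hB n x). specialize (hn1 n).
    set (q := / (INR n + 1)) in *.
    assert (hq : m * q < e) by (apply Rmult_lt_of_div; lra).
    rewrite Rsqr_mult. unfold m in hq. unfold Rsqr at 1 3.
    assert (hW : 0 <= M² * sq i x) by (pose proof (Rle_0_sqr M); nra).
    set (W := M² * sq i x) in *. rewrite !Rmult_assoc. fold W.
    replace ((c + q) * ((c + q) * W)) with (c * (c * W) + (2 * c + q) * q * W) by ring.
    assert ((2 * c + q) * (q * W) <= (2 * c + 1) * (q * W))
      by (apply Rmult_le_compat_r; [apply Rmult_le_pos|]; lra).
    lra.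
  - intros x.
    assert (hlow : tau2 / tau1 * sq i (T tau2 x) <= Re (RtoC M² * b x x)).
    { apply (tends_Re_ge (F := U)) with (u := fun n => (RtoC M² * B n x x)%C).
      - intros e he. apply filter_forall. intros n.
        replace (Re (RtoC M² * B n x x)) with (M² * sq (B n) x) by (unfold Re; simpl; ring).
        assert (tau2 / tau1 * sq i (T tau2 x) <= M² * sq (B n) x); [|lra].
        apply average_ge; [apply hp|lia|apply hp].
      - apply tends_scal, hb. }
    replace (M² * sq b x) with (Re (RtoC M² * b x x)) by (unfold Re; simpl; ring). easy.
Qed.

End Averaging.

(** * Unitary dilation of a contractive semigroup *)

Lemma form_Re_congr {G : Type} {add : G -> G -> G} {scl : C -> G -> G} {p : G -> G -> C}
  (Hp : psd_form add scl p) (x y : G) :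
  (forall w, p x w = p y w) -> Re (p x x) = Re (p y y).
Proof. intros h. rewrite h, (form_conj _ _ _ Hp x y), h. reflexivity. Qed.

Section Dilation.

Context {G : Type} {add : G -> G -> G} {scl : C -> G -> G} {b : G -> G -> C}.
Hypothesis Hb : psd_form add scl b.
Variable g0 : G.
Variable T : R -> G -> G.
Hypothesis T_add : forall t x y, 0 <= t -> T t (add x y) = add (T t x) (T t y).
Hypothesis T_scl : forall t a x, 0 <= t -> T t (scl a x) = scl a (T t x).
Hypothesis T_0 : forall x, T 0 x = x.
Hypothesis T_plus : forall s t x, 0 <= s -> 0 <= t -> T (s + t) x = T s (T t x).
Hypothesis T_contr : forall t x, 0 <= t -> Re (b (T t x) (T t x)) <= Re (b x x).

(* The list [(t_1, x_1), ...] stands for the vector [U(t_1) x_1 + ...] of the dilation space. *)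
Definition kern (u v : R * G) : C :=
  b (T (Rmax (fst u - fst v) 0) (snd u)) (T (Rmax (fst v - fst u) 0) (snd v)).

Fixpoint kern_l (u : R * G) (m : list (R * G)) : C :=
  match m with nil => RtoC 0 | v :: m => (kern u v + kern_l u m)%C end.

Fixpoint ker (l m : list (R * G)) : C :=
  match l with nil => RtoC 0 | u :: l => (kern_l u m + ker l m)%C end.

Definition lscl (a : C) (l : list (R * G)) : list (R * G) :=
  map (fun u => (fst u, scl a (snd u))) l.

Definition shift (t : R) (l : list (R * G)) : list (R * G) :=
  map (fun u => (fst u + t, snd u)) l.

(** The compression to the original space of [U(-t)] applied to the formal sum, provided [t]
    precedes all times in the list; [scl 0 g0] stands in for zero. *)
Fixpoint orbit_sum (t : R) (l : list (R * G)) : G :=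
  match l with nil => scl (RtoC 0) g0 | u :: l => add (T (fst u - t) (snd u)) (orbit_sum t l) end.

Lemma kern_conj u v : kern v u = Cconj (kern u v).
Proof. apply (form_conj _ _ _ Hb). Qed.

Lemma kern_add_l s x y v : kern (s, add x y) v = (kern (s, x) v + kern (s, y) v)%C.
Proof. unfold kern. simpl. rewrite T_add by apply Rmax_r. apply (form_add_l _ _ _ Hb). Qed.

Lemma kern_scl_l s a x v : kern (s, scl a x) v = (a * kern (s, x) v)%C.
Proof. unfold kern. simpl. rewrite T_scl by apply Rmax_r. apply (form_scl_l _ _ _ Hb). Qed.

Lemma kern_le s x v : s <= fst v -> kern (s, x) v = b x (T (fst v - s) (snd v)).
Proof.
  intros h. unfold kern. simpl. rewrite Rmax_right, Rmax_left by lra. now rewrite T_0.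
Qed.

Lemma kern_l_add_l s x y m : kern_l (s, add x y) m = (kern_l (s, x) m + kern_l (s, y) m)%C.
Proof. induction m as [|v m IH]; simpl; [ring|]. rewrite kern_add_l, IH. ring. Qed.

Lemma kern_l_scl_l s a x m : kern_l (s, scl a x) m = (a * kern_l (s, x) m)%C.
Proof. induction m as [|v m IH]; simpl; [ring|]. rewrite kern_scl_l, IH. ring. Qed.

Lemma ker_app_l l l' m : ker (l ++ l') m = (ker l m + ker l' m)%C.
Proof. induction l as [|u l IH]; simpl; [ring|]. rewrite IH. ring. Qed.

Lemma ker_scl_l a l m : ker (lscl a l) m = (a * ker l m)%C.
Proof.
  induction l as [|[s x] l IH]; simpl; [ring|]. rewrite IH, kern_l_scl_l. ring.
Qed.

Lemma ker_cons_r l v m : ker l (v :: m) = (Cconj (kern_l v l) + ker l m)%C.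
Proof.
  induction l as [|u l IH]; simpl.
  - Cpair_ring.
  - rewrite IH, (kern_conj v u). Cpair_ring.
Qed.

Lemma ker_nil_r l : ker l nil = RtoC 0.
Proof. induction l as [|u l IH]; simpl; [easy|]. rewrite IH. ring. Qed.

Lemma ker_conj l m : ker m l = Cconj (ker l m).
Proof.
  induction l as [|u l IH]; simpl.
  - rewrite ker_nil_r. Cpair_ring.
  - rewrite ker_cons_r, IH. Cpair_ring.
Qed.

(** Lists are not identified up to order; this lets the earliest time be brought to the front. *)
Lemma ker_perm l l' : Permutation l l' -> ker l l = ker l' l'.
Proof.
  intros h.
  assert (hl : forall m, ker l m = ker l' m).
  { intros m. induction h; simpl; try congruence. ring. }
  now rewrite hl, ker_conj, hl, <- ker_conj.
Qed.

Lemma orbit_sum_perm {p : G -> G -> C} (Hp : psd_form add scl p) t l l' w :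
  Permutation l l' -> p (orbit_sum t l) w = p (orbit_sum t l') w.
Proof.
  induction 1; simpl; rewrite ?(form_add_l _ _ _ Hp); try congruence. ring.
Qed.

(** Equality is claimed only under a form: the final [scl 0 g0] becomes [scl 0 (T r g0)], perhaps a
    different element, but one that also pairs to [0]. *)
Lemma orbit_sum_T {p : G -> G -> C} (Hp : psd_form add scl p) r s l w : 0 <= r ->
  List.Forall (fun u => s <= fst u) l -> p (T r (orbit_sum s l)) w = p (orbit_sum (s - r) l) w.
Proof.
  intros hr. induction 1 as [|u l hu _ IH]; simpl.
  - rewrite T_scl, !(form_scl_l _ _ _ Hp) by easy. ring.
  - rewrite T_add, !(form_add_l _ _ _ Hp), IH, <- T_plus by lra.
    do 3 f_equal. ring.
Qed.

Lemma kern_l_orbit_sum s x l : List.Forall (fun u => s <= fst u) l ->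
  kern_l (s, x) l = b x (orbit_sum s l).
Proof.
  induction 1 as [|u l hu _ IH]; simpl.
  - rewrite (form_scl_r Hb). Cpair_ring.
  - rewrite kern_le, IH, (form_add_r Hb); easy.
Qed.

Lemma exists_min (l : list (R * G)) : l <> nil ->
  exists u l', Permutation l (u :: l') /\ List.Forall (fun v => fst u <= fst v) l'.
Proof.
  induction l as [|v l IH]; [easy|]. intros _.
  destruct l as [|w l].
  - exists v, nil. split; [apply Permutation_refl|constructor].
  - destruct IH as [u [l' [hp hl]]]; [easy|].
    destruct (Rle_dec (fst v) (fst u)) as [h|h].
    + exists v, (w :: l). split; [apply Permutation_refl|].
      apply (Permutation_Forall (Permutation_sym hp)). constructor; [easy|].
      revert hl. apply Forall_impl. intros a ha. lra.
    + exists u, (v :: l'). split.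
      * apply perm_trans with (v :: u :: l'); [now constructor|apply perm_swap].
      * constructor; [lra|easy].
Qed.

(* Compressing [U(s_1) x_1 + ...] to the original space at a time [t] before all the [s_i]
   is a contraction; in particular the kernel is positive. *)
Lemma orbit_sum_le_ker t l : List.Forall (fun u => t <= fst u) l ->
  Re (b (orbit_sum t l) (orbit_sum t l)) <= Re (ker l l).
Proof.
  remember (length l) as n eqn:hn. revert t l hn.
  induction n as [|n IH]; intros t l hn hl.
  - destruct l; [|easy]. simpl. rewrite (form_scl_l _ _ _ Hb). unfold Re. simpl. lra.
  - destruct (exists_min l) as [[s x] [l' [hp hs]]]; [now intros ->|]. simpl in hs.
    assert (hl' := Permutation_Forall hp hl). inversion_clear hl' as [|? ? ht hl'']. simpl in ht.
    apply Permutation_length in hp as hlen. rewrite <- hn in hlen. injection hlen as hlen.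
    rewrite (ker_perm _ _ hp).
    (* With [s] the earliest time, the compression at [t] is [T(s-t)] of the one at [s], so
       contractivity reduces the claim to [t = s]. *)
    rewrite (form_Re_congr Hb _ (T (s - t) (orbit_sum s ((s, x) :: l')))).
    2:{ intros w. rewrite (orbit_sum_perm Hb t _ _ w hp), (orbit_sum_T Hb).
        - do 2 f_equal. ring.
        - lra.
        - constructor; [simpl; lra|easy]. }
    eapply Rle_trans; [apply T_contr; lra|].
    (* At time [s] the compression is [x + y], with [y] from the later terms. The square of [x] and
       the cross term [b(x,y)] agree on both sides, and the induction hypothesis compares what is
       left. *)
    simpl orbit_sum. rewrite Rminus_diag, T_0, (form_Re_add Hb).
    simpl ker. rewrite ker_cons_r, kern_l_orbit_sum by easy.
    rewrite kern_le by (simpl; lra). simpl. rewrite Rminus_diag, T_0.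
    specialize (IH s l' hlen hs). unfold Re in *. simpl. lra.
Qed.

Lemma ker_psd : psd_form (fun l m => l ++ m) lscl ker.
Proof.
  split.
  - intros x y z. apply ker_app_l.
  - intros a x y. apply ker_scl_l.
  - intros x y. apply ker_conj.
  - intros l. destruct l as [|u0 l0]; [simpl; lra|].
    destruct (exists_min (u0 :: l0)) as [u [l' [hp hs]]]; [easy|].
    refine (Rle_trans _ _ _ (form_pos _ _ _ Hb (orbit_sum (fst u) (u0 :: l0))) _).
    apply orbit_sum_le_ker. apply (Permutation_Forall (Permutation_sym hp)).
    constructor; [lra|easy].
Qed.

(** Only differences of times enter the kernel, so a shift passes to the other argument with the
    opposite sign. *)
Lemma kern_shift t u v : kern (fst u + t, snd u) v = kern u (fst v + - t, snd v).
Proof. unfold kern. simpl. do 2 f_equal; f_equal; ring. Qed.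

Lemma ker_shift t l m : ker (shift t l) m = ker l (shift (- t) m).
Proof.
  assert (h : forall u, kern_l (fst u + t, snd u) m = kern_l u (shift (- t) m)).
  { intros u. induction m as [|v m IH]; simpl; [easy|]. now rewrite IH, kern_shift. }
  induction l as [|u l IH]; simpl; [easy|]. now rewrite h, IH.
Qed.

Lemma shift_shift s t l : shift s (shift t l) = shift (t + s) l.
Proof.
  unfold shift. rewrite map_map. apply map_ext. intros u. simpl. f_equal. ring.
Qed.

Lemma shift_0 l : shift 0 l = l.
Proof.
  unfold shift. rewrite <- (map_id l) at 2. apply map_ext. intros [s x]. simpl. f_equal. ring.
Qed.

Lemma shift_opp_l t l : shift (- t) (shift t l) = l.
Proof. rewrite shift_shift, Rplus_opp_r. apply shift_0. Qed.

Lemma seminorm_shift t l : seminorm ker (shift t l) = seminorm ker l.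
Proof. unfold seminorm. now rewrite ker_shift, shift_opp_l. Qed.

Lemma rep_shift t (f : list (R * G) -> C) s :
  rep (ip := ker) f s -> rep (ip := ker) (fun z => f (shift (- t) z)) (fun n => shift t (s n)).
Proof.
  intros h e he. refine (filter_imp (F := eventually) _ _ _ (h e he)). intros n hn z.
  rewrite ker_shift, <- (seminorm_shift (- t) z). apply hn.
Qed.

Lemma rep_shift_ex t (f : completion (ip := ker)) :
  exists s, rep (ip := ker) (fun z => kev f (shift (- t) z)) s.
Proof.
  destruct (proj2_sig f) as [s hs]. exists (fun n => shift t (s n)). now apply rep_shift.
Qed.

(** The group acts on functionals through the adjoint: [<U(t)f, z> = <f, U(-t)z>]. *)
Definition dilation (t : R) (f : completion (ip := ker)) : completion (ip := ker) :=
  exist _ _ (rep_shift_ex t f).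

Definition dilation_space : Hilbert := completion_Hilbert ker_psd nil.

Local Notation N := (seminorm (kip ker_psd)).
Local Notation "f -- g" := (fsub (kplus ker_psd) (kscal ker_psd) f g)
  (at level 50, left associativity).

Lemma dilation_isometry t f g :
  kip ker_psd (dilation t f) (dilation t g) = kip ker_psd f g.
Proof.
  destruct (proj2_sig g) as [s hs].
  apply (tends_unique (F := eventually))
    with (1 := kip_spec ker_psd (dilation t f) (dilation t g) _ (rep_shift t _ s hs)).
  apply tends_ext with (2 := kip_spec ker_psd f g s hs).
  intros n. simpl. now rewrite shift_opp_l.
Qed.

Lemma dilation_plus s t f : dilation (s + t) f = dilation s (dilation t f).
Proof.
  apply completion_ext. intros z. simpl. rewrite shift_shift. do 2 f_equal. ring.
Qed.

Lemma dilation_0 f : dilation 0 f = f.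
Proof. apply completion_ext. intros z. simpl. now rewrite Ropp_0, shift_0. Qed.

Lemma dilation_hat t l : dilation t (hat l) = hat (shift t l).
Proof. apply completion_ext. intros z. simpl. now rewrite ker_shift. Qed.

Lemma dilation_unitary t : @unitary dilation_space (dilation t).
Proof.
  split; [split; [|split]|split].
  - intros f g. now apply completion_ext.
  - intros a f. now apply completion_ext.
  - exists 1. intros f. rewrite Rmult_1_l. right.
    change (N (dilation t f) = N f). unfold seminorm. now rewrite dilation_isometry.
  - intros f g. apply dilation_isometry.
  - intros f. exists (dilation (- t) f).
    rewrite <- dilation_plus, Rplus_opp_r. apply dilation_0.
Qed.

Hypothesis T_near : forall x e, 0 < e -> exists d, 0 < d /\ forall t, 0 <= t < d ->
  seminorm b (fsub add scl (T t x) x) < e.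

Local Notation lsub := (fsub (fun l m : list (R * G) => l ++ m) lscl).

(** For one generator, [|U(t)x - x|^2 = 2 b(x,x) - 2 Re b(T(|t|)x, x) <= 2 |x| |T(|t|)x - x|] in the
    seminorm of [b], so right continuity of [T] covers both signs of [t]. A product below [e^2/8]
    makes this at most [(e/2)^2]. *)
Lemma shift_continuous l e : 0 < e ->
  exists d, 0 < d /\ forall t, Rabs t < d -> seminorm ker (lsub (shift t l) l) < e.
Proof.
  revert e. induction l as [|[s x] l IH]; intros e he.
  - exists 1. split; [lra|]. intros t _. simpl. unfold seminorm. simpl. now rewrite sqrt_0.
  - destruct (IH (e / 2)) as [d [hd hdl]]; [lra|].
    pose proof (seminorm_ge_0 (ip := b) x) as hx.
    destruct (T_near x (e * e / 8 / (seminorm b x + 1))) as [d' [hd' hT]].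
    { apply Rdiv_lt_0_compat; nra. }
    exists (Rmin d d'). split; [now apply Rmin_glb_lt|]. intros t ht.
    pose proof (Rmin_l d d'). pose proof (Rmin_r d d').
    specialize (hdl t ltac:(lra)). specialize (hT (Rabs t)).
    specialize (hT ltac:(split; [apply Rabs_pos|lra])).
    apply Rle_lt_trans with
      (seminorm ker (lsub ((s + t, x) :: nil) ((s, x) :: nil)) + seminorm ker (lsub (shift t l) l)).
    + apply (seminorm_le_add_of_dual ker_psd). intros w.
      rewrite !(form_sub_l ker_psd). simpl. ring.
    + assert (h : seminorm ker (lsub ((s + t, x) :: nil) ((s, x) :: nil)) <= e / 2); [|lra].
      apply Rsqr_incr_0_var; [|lra]. unfold Rsqr.
      rewrite (seminorm_sqr ker_psd), (form_Re_sub ker_psd).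
      assert (E1 : forall r, Re (ker ((r, x) :: nil) ((r, x) :: nil)) = Re (b x x)).
      { intros r. simpl. rewrite kern_le by (simpl; lra). simpl. rewrite Rminus_diag, T_0.
        unfold Re. simpl. ring. }
      assert (E2 : Re (ker ((s + t, x) :: nil) ((s, x) :: nil)) = Re (b (T (Rabs t) x) x)).
      { simpl. transitivity (Re (kern (s + t, x) (s, x))); [unfold Re; simpl; ring|].
        destruct (Rle_dec 0 t) as [h|h].
        - rewrite kern_conj, kern_le by (simpl; lra). simpl. rewrite Rabs_pos_eq by easy.
          replace (s + t - s) with t by ring. rewrite <- (form_Re_sym Hb). reflexivity.
        - rewrite kern_le by (simpl; lra). simpl. rewrite Rabs_left by lra.
          replace (s - (s + t)) with (- t) by ring. apply (form_Re_sym Hb). }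
      rewrite !E1, E2.
      pose proof (form_cauchy_schwarz Hb (fsub add scl (T (Rabs t) x) x) x) as hcs.
      pose proof (re_le_Cmod (b (fsub add scl (T (Rabs t) x) x) x)) as hre.
      apply Rabs_le_between in hre. rewrite (form_sub_l Hb) in hre, hcs.
      change (Re (b (T (Rabs t) x) x - b x x)) with (Re (b (T (Rabs t) x) x) - Re (b x x)) in hre.
      assert (seminorm b x * seminorm b (fsub add scl (T (Rabs t) x) x) < e * e / 8)
        by (apply Rmult_lt_of_div; [easy|nra|easy]).
      lra.
Qed.

(** By density [f] is within [e/4] of a formal sum [z]; shift invariance carries this error over to
    time [t], and continuity for [z] does the rest. *)
Lemma dilation_continuous f e : 0 < e ->
  exists d, 0 < d /\ forall t, Rabs t < d -> N (dilation t f -- f) < e.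
Proof.
  intros he. pose proof (completion_form ker_psd) as fK.
  destruct (hat_dense f (e / 4) ltac:(lra)) as [z hz].
  destruct (shift_continuous z (e / 4) ltac:(lra)) as [d [hd hdz]].
  exists d. split; [easy|]. intros t ht. specialize (hdz t ht).
  apply Rle_lt_trans with (3 * (e / 4)); [|lra].
  apply kip_seminorm_le; [lra|]. intros x. simpl.
  pose proof (hz x) as h1. pose proof (hz (shift (- t) x)) as h2.
  rewrite seminorm_shift in h2.
  pose proof (form_cauchy_schwarz ker_psd (lsub (shift t z) z) x) as h3.
  rewrite (form_sub_l ker_psd), ker_shift in h3.
  replace (kev f (shift (- t) x) + - (1) * kev f x)%C with
    ((kev f (shift (- t) x) - ker z (shift (- t) x)) +
     ((ker z (shift (- t) x) - ker z x) + - (kev f x - ker z x)))%C by ring.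
  apply Rle_trans with (1 := Cmod_triangle _ _).
  pose proof (Cmod_triangle (ker z (shift (- t) x) - ker z x) (- (kev f x - ker z x))) as h4.
  rewrite Cmod_opp in h4. pose proof (seminorm_ge_0 (ip := ker) x).
  assert (seminorm ker (lsub (shift t z) z) * seminorm ker x <= e / 4 * seminorm ker x)
    by (apply Rmult_le_compat_r; lra).
  lra.
Qed.

Lemma dilation_C0_group : @unitary_C0_group dilation_space dilation.
Proof.
  split; [exact dilation_unitary|split; [exact dilation_0|split; [exact dilation_plus|]]].
  intros f.
  apply (filterlim_locally_ball_norm (U := dilation_space) (fun t => dilation t f) f).
  intros e. destruct (dilation_continuous f e (cond_pos e)) as [d [hd h]].
  exists (mkposreal d hd). intros t ht. apply (h t).
  change (Rabs (t - 0) < d) in ht. now rewrite Rminus_0_r in ht.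
Qed.

Definition embed (x : G) : dilation_space := hat (ip := ker) ((0, x) :: nil).

Lemma embed_Re x : Re (kip ker_psd (embed x) (embed x)) = Re (b x x).
Proof.
  unfold embed. rewrite kip_hat. simpl. rewrite kern_le by (simpl; lra). simpl.
  rewrite Rminus_diag, T_0. unfold Re. simpl. ring.
Qed.

End Dilation.

(** * From the similarity to the dilation in a Hilbert space *)

Lemma Hilbert_Re (H : Hilbert) (x : H) : Re (inner H x x) = (norm x)².
Proof. rewrite Hilbert_norm. symmetry. exact (seminorm_sqr (Hilbert_form H) x). Qed.

Lemma Hilbert_Re_le {H K : Hilbert} (x : H) (y : K) (a : R) : 0 <= a ->
  norm x <= a * norm y -> Re (inner H x x) <= a² * Re (inner K y y).
Proof.
  intros ha h. rewrite !Hilbert_Re, <- Rsqr_mult.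
  apply Rsqr_incr_1; [easy|apply norm_ge_0|]. apply Rmult_le_pos; [easy|apply norm_ge_0].
Qed.

Lemma semigroup_invariant_form (H : Hilbert) (T : R -> H -> H) (tau1 tau2 M c : R) :
  C0_semigroup T -> 0 < tau2 <= tau1 -> similar_to_contraction (T tau1) ->
  0 <= M -> (forall t x, 0 <= t <= tau1 -> norm (T t x) <= M * norm x) ->
  sim_const (T tau1) = Finite c ->
  exists b, @psd_form H plus scal b /\
    (forall t x, 0 <= t -> Re (b (T t x) (T t x)) <= Re (b x x)) /\
    (forall x, Re (b x x) <= (c * M)² * Re (inner H x x)) /\
    (forall x, tau2 / tau1 * Re (inner H (T tau2 x) (T tau2 x)) <= M² * Re (b x x)).
Proof.
  intros HT htau hsim hM hb hc.
  destruct (sim_const_finite (T tau1)) as [c' [hc' [hc0 hS]]]; [apply HT; lra|easy|].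
  rewrite hc in hc'. injection hc' as <-.
  pose proof HT as [hlin [hT0 [hTp _]]].
  apply (invariant_form (Hilbert_form H) T) with (1 := fun t x y ht => proj1 (hlin t ht) x y)
    (2 := fun t a x ht => proj1 (proj2 (hlin t ht)) a x); auto.
  - intros t x ht. apply Hilbert_Re_le; auto.
  - intros x e he. destruct (C0_near HT x e he) as [d [hd h]]. exists d. split; [easy|].
    intros t ht. rewrite <- Hilbert_sub, <- Hilbert_norm. exact (h t ht).
  - intros e he. destruct (hS e he) as [S [a [b [hSlin [ha [hb0 [h1 [h2 [h3 h4]]]]]]]]].
    assert (E : forall x y : H, Re (RtoC b² * inner H x y) = b² * Re (inner H x y))
      by (intros; unfold Re; simpl; ring).
    pose proof (Rle_0_sqr b).
    (* Here [b] bounds the inverse similarity: the factor [b^2] gives [|x|^2 <= p(x,x)], and the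
       upper constant becomes [(a b)^2]. *)
    exists (fun x y => RtoC b² * inner H (S x) (S y))%C. split; [|split; [|split]].
    + apply psd_scale; [easy|]. destruct hSlin as [hadd [hscl _]].
      exact (psd_pull (inner H) S (Hilbert_form H) hadd hscl).
    + intros x. rewrite !E. apply Rmult_le_compat_l; [easy|].
      rewrite <- (Rmult_1_l (Re (inner H (S x) (S x)))), <- Rsqr_1.
      apply Hilbert_Re_le; [lra|]. rewrite Rmult_1_l. apply h3.
    + intros x. rewrite E. now apply Hilbert_Re_le.
    + intros x. rewrite E.
      apply Rle_trans with (b² * (a² * Re (inner H x x))).
      * apply Rmult_le_compat_l; [easy|]. now apply Hilbert_Re_le.
      * rewrite <- Rmult_assoc, <- Rsqr_mult.
        apply Rmult_le_compat_r; [apply inner_pos|]. rewrite Rmult_comm.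
        apply Rsqr_incr_1; [easy|now apply Rmult_le_pos|lra].
Qed.

Theorem theorem4p9 (H : Hilbert) (T : R -> H -> H) (tau1 : R) :
  C0_semigroup T -> 0 < tau1 ->
  similar_to_contraction (T tau1) ->
  forall tau2 : R, 0 < tau2 <= tau1 ->
  exists (K : Hilbert) (A : K -> H) (B : H -> K) (U : R -> K -> K),
    bounded_linear A /\ bounded_linear B /\ unitary_C0_group U /\
    (forall t x, tau2 <= t -> T t x = A (U t (B x))) /\
    Rbar_le (Rbar_mult (opnorm A) (opnorm B))
      (Rbar_mult (sim_const (T tau1))
         (Rbar_mult (Rbar_mult (sup_norm_on T tau1) (sup_norm_on T tau1))
            (Finite (sqrt (tau1 / tau2))))).
Proof.
  intros HT htau1 hsim tau2 htau.
  destruct (sup_norm_finite HT (norm_cauchy_limit H) tau1 ltac:(lra)) as [M [EM [hM hMb]]].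
  destruct (sim_const_finite (T tau1)) as [c [Ec [hc _]]]; [apply HT; lra|easy|].
  destruct (semigroup_invariant_form H T tau1 tau2 M c HT htau hsim hM hMb Ec)
    as [b [Hb [hcontr [hup hlow]]]].
  pose proof HT as [hlin [hT0 [hTp _]]].
  assert (T_add : forall t (x y : H), 0 <= t -> T t (plus x y) = plus (T t x) (T t y))
    by (intros; now apply hlin).
  assert (T_scl : forall t (a : C) (x : H), 0 <= t -> T t (scal a x) = scal a (T t x))
    by (intros; now apply hlin).
  (* The form is dominated by the norm of [H], so strong continuity passes to its seminorm. *)
  assert (b_near : forall (x : H) e, 0 < e -> exists d, 0 < d /\ forall t, 0 <= t < d ->
    seminorm b (@fsub H plus scal (T t x) x) < e).
  { intros x e he. assert (hcM : 0 <= c * M) by now apply Rmult_le_pos.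
    destruct (C0_near HT x (e / (c * M + 1))) as [d [hd h]];
      [apply Rdiv_lt_0_compat; lra|].
    exists d. split; [easy|]. intros t ht. specialize (h t ht).
    apply Rle_lt_trans with (c * M * norm (minus (T t x) x : H)).
    - apply Rsqr_incr_0_var.
      + rewrite Rsqr_mult. unfold Rsqr at 1. rewrite (seminorm_sqr Hb).
        rewrite <- Hilbert_Re, Hilbert_sub. apply hup.
      + apply Rmult_le_pos; [easy|apply norm_ge_0].
    - now apply Rmult_lt_of_div. }
  set (K := dilation_space Hb zero T T_add T_scl hT0 hTp hcontr).
  set (q := M * sqrt (tau1 / tau2)).
  assert (hq : 0 <= q) by (apply Rmult_le_pos; [easy|apply sqrt_pos]).
  assert (hq2 : q² = M² * (tau1 / tau2)).
  { unfold q. rewrite Rsqr_mult, Rsqr_sqrt; [easy|]. apply Rdiv_le_0_compat; lra. }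
  set (kr := ker (b := b) T).
  (* Fixing [h] by its pairings determines it in [H], and lets concatenated lists match sums of
     values despite the stand-ins for zero. *)
  set (S := fun (k : K) (h : H) => exists l, List.Forall (fun u => tau2 <= fst u) l /\
    k = hat (ip := kr) l /\
    forall w, inner H h w = inner H (orbit_sum (add := plus) (scl := scal) zero T 0 l) w).
  set (Hker := ker_psd Hb zero T T_add T_scl hT0 hTp hcontr).
  destruct (graph_extension (K := K) (H := H) (S := S) hq) as [A [hA [hAq hAS]]].
  - exists (hat (ip := kr) nil), (scal (RtoC 0) zero). exists nil.
    split; [constructor|split; easy].
  - intros k h k' h' [l [hl [-> hh]]] [l' [hl' [-> hh']]]. exists (l ++ l').
    split; [now apply Forall_app|split].
    + apply completion_ext. intros z. simpl. symmetry. apply ker_app_l.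
    + intros w. rewrite inner_plus_l, hh, hh'. clear. induction l as [|u l IH]; simpl.
      * rewrite inner_scal_l. ring.
      * rewrite !inner_plus_l, <- Cplus_assoc. apply f_equal. exact IH.
  - intros a k h [l [hl [-> hh]]]. exists (lscl (scl := scal) a l). split; [|split].
    + unfold lscl. apply Forall_map. exact hl.
    + apply completion_ext. intros z. simpl. symmetry. now apply (ker_scl_l Hb).
    + intros w. rewrite inner_scal_l, hh. clear - hl T_scl htau. induction hl as [|u l hu _ IH]; simpl.
      * rewrite inner_scal_l. ring.
      * rewrite !inner_plus_l, Cmult_plus_distr_l. apply f_equal2; [|exact IH].
        rewrite T_scl by lra. symmetry. apply inner_scal_l.
  - intros k h [l [hl [-> hh]]]. apply Rsqr_incr_0_var.
    2:{ apply Rmult_le_pos; [easy|apply seminorm_ge_0]. }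
    rewrite Rsqr_mult, hq2. unfold Rsqr at 1 3.
    rewrite (seminorm_sqr (Hilbert_form H)), (seminorm_sqr (Hilbert_form K)).
    change (inner K) with (kip Hker). rewrite kip_hat.
    (* As all times are at least [tau2], the value is [T tau2 z]. Vectors of this kind are what
       [hlow] controls, and [orbit_sum_le_ker] compares [z] with the formal sum. *)
    rewrite (form_Re_congr (Hilbert_form H) h
      (T tau2 (orbit_sum (add := plus) (scl := scal) zero T tau2 l))).
    2:{ intros w. rewrite hh, (orbit_sum_T zero T T_add T_scl hTp (Hilbert_form H)); [|lra|easy].
        now rewrite Rminus_diag. }
    set (z := orbit_sum (add := plus) (scl := scal) zero T tau2 l).
    apply Rle_trans with (M² * (tau1 / tau2) * Re (b z z)).
    + apply Rle_trans with (tau1 / tau2 * (tau2 / tau1 * Re (inner H (T tau2 z) (T tau2 z)))).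
      * right. field. lra.
      * rewrite (Rmult_comm M²), Rmult_assoc.
        apply Rmult_le_compat_l; [apply Rdiv_le_0_compat; lra|apply hlow].
    + apply Rmult_le_compat_l.
      * apply Rmult_le_pos; [apply Rle_0_sqr|apply Rdiv_le_0_compat; lra].
      * now apply (orbit_sum_le_ker Hb zero T T_add T_scl hT0 hTp hcontr).
  - set (B := embed Hb zero T T_add T_scl hT0 hTp hcontr : H -> K).
    assert (hBn : forall x, norm (B x) <= c * M * norm x).
    { intros x. apply Rsqr_incr_0_var.
      - rewrite Rsqr_mult, <- !Hilbert_Re.
        apply Rle_trans with (2 := hup x). right.
        apply (embed_Re Hb zero T T_add T_scl hT0 hTp hcontr).
      - repeat apply Rmult_le_pos; try easy. apply norm_ge_0. }
    assert (hB : bounded_linear B).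
    { split; [|split].
      - intros x y. apply completion_ext. intros z. simpl.
        rewrite (kern_l_add_l Hb T T_add). ring.
      - intros a x. apply completion_ext. intros z. simpl.
        rewrite (kern_l_scl_l Hb T T_scl). ring.
      - exists (c * M). exact hBn. }
    exists K, A, B, (dilation (b := b) T).
    split; [easy|split; [easy|split; [|split]]].
    + now apply dilation_C0_group.
    (* [U(t)Bx] is the one-term sum at time [0 + t]; [tau2 <= t] places it in the domain of the
       graph [S]. *)
    + intros t x ht. symmetry. apply hAS. exists ((0 + t, x) :: nil). split; [|split].
      * constructor; [simpl; lra|constructor].
      * exact (dilation_hat T t ((0, x) :: nil)).
      * intros w. simpl. rewrite inner_plus_l, inner_scal_l.
        replace (0 + t - 0) with t by ring. ring.
    + destruct (opnorm_finite A hA) as [a [Ea [ha _]]].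
      destruct (opnorm_finite B hB) as [b' [Eb [hb' _]]].
      pose proof (opnorm_le A q hq hAq) as h1.
      pose proof (opnorm_le B (c * M) (Rmult_le_pos _ _ hc hM) hBn) as h2.
      rewrite Ea in h1 |- *. rewrite Eb in h2 |- *. rewrite EM, Ec. simpl in *.
      apply Rle_trans with (q * (c * M)); [now apply Rmult_le_compat|].
      unfold q. right. ring.
Qed.
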